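(* Let $f=h+\overline g$ be a locally univalent harmonic mapping in a simply connected domain $\Omega\subset\mathbb{C}$ (with $h,g$ analytic in $\Omega$), and let $\alpha\in\Omega$ satisfy $f(\alpha)=0$. Put $$J(z)=|h'(z)|^2-|g'(z)|^2,\qquad N(z)=\overline{h'(z)}\,f(z)-\overline{g'(z)\,f(z)},$$ $$A(z)=\left(\overline{h'(z)}-\frac{\overline{h''(z)}}{2}\,\frac{\overline{N(z)}}{J(z)}\right)f(z)-\left(\overline{g'(z)}-\frac{\overline{g''(z)}}{2}\,\frac{\overline{N(z)}}{J(z)}\right)\overline{f(z)},$$ $$B(z)=\left|h'(z)-\frac{h''(z)}{2}\,\frac{N(z)}{J(z)}\right|^2-\left|g'(z)-\frac{g''(z)}{2}\,\frac{N(z)}{J(z)}\right|^2,$$ and let $$F^{H_H}(z)=z-\frac{A(z)}{B(z)}$$ be the generating function of the harmonic Halley method (considered near $\alpha$). Then $$F^{H_H}(\alpha)=\alpha,\qquad \frac{\partial F^{H_H}}{\partial z}(\alpha)=\frac{\partial^2 F^{H_H}}{\partial z^2}(\alpha)=0,\qquad \frac{\partial^3 F^{H_H}}{\partial z^3}(\alpha)=-S_H(f)(\alpha),$$ where $S_H(f)$ is the harmonic Schwarzian derivative of $f$.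
   Context: A complex-valued function is harmonic if its real and imaginary parts are (real) harmonic. In a simply connected domain every harmonic function has a canonical decomposition $f=h+\overline{g}$ with $h,g$ analytic, unique up to an additive constant. Locally univalent means locally injective; by Lewy's theorem, $f=h+\overline g$ is locally univalent if and only if its Jacobian $J=|h'|^2-|g'|^2$ does not vanish. The Wirtinger operators, with $z=x+iy$, are $\frac{\partial}{\partial z}=\frac12\left(\frac{\partial}{\partial x}-i\frac{\partial}{\partial y}\right)$ and $\frac{\partial}{\partial\overline z}=\frac12\left(\frac{\partial}{\partial x}+i\frac{\partial}{\partial y}\right)$. A locally univalent harmonic $f=h+\overline g$ is orientation-preserving if $|h'|>|g'|$, and orientation-reversing otherwise (equivalently, $\overline f$ is orientation-preserving). For orientation-preserving $f$, its dilatation is the analytic function $\omega=g'/h'$ (so $|\omega|<1$), the harmonic pre-Schwarzian derivative is $P_H(f)=\frac{\partial}{\partial z}\log J=\frac{h''}{h'}-\frac{\overline{\omega}\,\omega'}{1-|\omega|^2}$, and the harmonic Schwarzian derivative is $$S_H(f)=\frac{\partial}{\partial z}\big(P_H(f)\big)-\frac12\big(P_H(f)\big)^2=S(h)+\frac{\overline\omega}{1-|\omega|^2}\left(\frac{h''}{h'}\,\omega'-\omega''\right)-\frac32\left(\frac{\omega'\,\overline\omega}{1-|\omega|^2}\right)^2,$$ where $S(h)=\frac{h'''}{h'}-\frac32\left(\frac{h''}{h'}\right)^2$ is the classical Schwarzian derivative of the locally univalent analytic function $h$. For orientation-reversing $f$, $P_H(f)=P_H(\overline f)$ and $S_H(f)=S_H(\overline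 f)$; in both cases $P_H(f)=\frac{\partial}{\partial z}\log|J|$. *)

(* Defs.v *)
From Stdlib Require Import Reals.
From Coquelicot Require Import Coquelicot.
Open Scope R_scope.

(* A continuous map on [0,1] (or on [0,1]^2) extends continuously to R (to R^2)
   by clamping the parameters, so that paths and homotopies may be taken
   continuous everywhere and constrained on [0,1] only. *)
Definition is_path (D : C -> Prop) (a b : C) (gamma : R -> C) : Prop :=
  (forall t : R, continuous gamma t) /\
  (forall t : R, 0 <= t <= 1 -> D (gamma t)) /\
  gamma 0 = a /\ gamma 1 = b.

Definition path_connected (D : C -> Prop) : Prop :=
  forall a b : C, D a -> D b -> exists gamma : R -> C, is_path D a b gamma.

Definition null_homotopic (D : C -> Prop) (a : C) (gamma : R -> C) : Prop :=
  exists H : R * R -> C,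
    (forall p : R * R, continuous H p) /\
    (forall s t : R, 0 <= s <= 1 -> 0 <= t <= 1 -> D (H (s, t))) /\
    (forall t : R, 0 <= t <= 1 -> H (0, t) = gamma t) /\
    (forall t : R, 0 <= t <= 1 -> H (1, t) = a) /\
    (forall s : R, 0 <= s <= 1 -> H (s, 0) = a /\ H (s, 1) = a).

Definition simply_connected_domain (D : C -> Prop) : Prop :=
  open D /\ path_connected D /\
  forall (a : C) (gamma : R -> C), is_path D a a gamma -> null_homotopic D a gamma.

Definition analytic_on (D : C -> Prop) (f : C -> C) : Prop :=
  forall z0 : C, D z0 ->
    exists (a : nat -> C) (r : posreal), forall z : C,
      Cmod (z - z0) < r ->
      @is_pseries C_AbsRing C_NormedModule a (z - z0)%C (f z).

(* On an open D, [ex_diff_n _ 2] at every point of D says that u is C^2 on D. *)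
Definition real_harmonic_on (D : C -> Prop) (u : C -> R) : Prop :=
  forall z : C, D z ->
    ex_diff_n (fun x y => u (x, y)) 2 (Re z) (Im z) /\
    partial_derive 2 0 (fun x y => u (x, y)) (Re z) (Im z)
      + partial_derive 0 2 (fun x y => u (x, y)) (Re z) (Im z) = 0.

Definition harmonic_on (D : C -> Prop) (f : C -> C) : Prop :=
  real_harmonic_on D (fun z => Re (f z)) /\ real_harmonic_on D (fun z => Im (f z)).

Definition locally_univalent_on (D : C -> Prop) (f : C -> C) : Prop :=
  forall z : C, D z ->
    exists U : C -> Prop, open U /\ U z /\
      forall z1 z2 : C, D z1 -> U z1 -> D z2 -> U z2 -> f z1 = f z2 -> z1 = z2.

(* [Dx], [Dy] and hence [Dz] are total; they are meaningful at the points where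
   [ex_Dz] holds. *)
Definition Dx (F : C -> C) (z : C) : C :=
  (Derive (fun x => Re (F (x, Im z))) (Re z),
   Derive (fun x => Im (F (x, Im z))) (Re z)).

Definition Dy (F : C -> C) (z : C) : C :=
  (Derive (fun y => Re (F (Re z, y))) (Im z),
   Derive (fun y => Im (F (Re z, y))) (Im z)).

Definition Dz (F : C -> C) (z : C) : C := (/ 2 * (Dx F z - Ci * Dy F z))%C.

Definition ex_Dz (F : C -> C) (z : C) : Prop :=
  @ex_derive R_AbsRing C_R_NormedModule (fun x : R => F (x, Im z)) (Re z) /\
  @ex_derive R_AbsRing C_R_NormedModule (fun y : R => F (Re z, y)) (Im z).

Definition jacobian (h g : C -> C) (z : C) : R :=
  Cmod (C_derive h z) ^ 2 - Cmod (C_derive g z) ^ 2.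

Definition halley_N (f h g : C -> C) (z : C) : C :=
  (Cconj (C_derive h z) * f z - Cconj (C_derive g z * f z))%C.

Definition halley_A (f h g : C -> C) (z : C) : C :=
  ((Cconj (C_derive h z)
      - Cconj (C_derive (C_derive h) z) / 2 * (Cconj (halley_N f h g z) / jacobian h g z))
     * f z
   - (Cconj (C_derive g z)
      - Cconj (C_derive (C_derive g) z) / 2 * (Cconj (halley_N f h g z) / jacobian h g z))
     * Cconj (f z))%C.

Definition halley_B (f h g : C -> C) (z : C) : R :=
  Cmod (C_derive h z
        - C_derive (C_derive h) z / 2 * (halley_N f h g z / jacobian h g z))%C ^ 2
  - Cmod (C_derive g z
        - C_derive (C_derive g) z / 2 * (halley_N f h g z / jacobian h g z))%C ^ 2.

Definition halley_map (f h g : C -> C) (z : C) : C := (z - halley_A f h g z / halley_B f h g z)%C.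

(* The orientation-preserving case, where the Jacobian is positive. *)
Definition pre_schwarzian_pos (h g : C -> C) : C -> C := Dz (fun z => RtoC (ln (jacobian h g z))).

Definition schwarzian_pos (h g : C -> C) (z : C) : C :=
  (Dz (pre_schwarzian_pos h g) z - / 2 * (pre_schwarzian_pos h g z * pre_schwarzian_pos h g z))%C.

(* S_H of h + conj g; in the orientation-reversing case it is that of the
   conjugate mapping g + conj h. *)
Definition harmonic_schwarzian (h g : C -> C) (z : C) : C :=
  if Rlt_dec (Cmod (C_derive g z)) (Cmod (C_derive h z))
  then schwarzian_pos h g z
  else schwarzian_pos g h z.

(* Main.v *)
Require Import Defs.
From Stdlib Require Import Reals Lra Lia Classical IndefiniteDescription.
From Coquelicot Require Import Coquelicot.
Open Scope R_scope.

(** Lewy's theorem makes the Jacobian J non-zero at alpha; after that the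
    statement is a computation with Taylor coefficients in the variable z alone.

    _Lewy's theorem_ ([lewy]).  Suppose that J vanishes at alpha, that is
    |h'| = |g'| there.  Then a suitable real-linear combination
    Re (c f) = Re phi, with phi = c h + conj c g analytic, has a critical point
    at alpha ([critical_direction]).  Hence phi - phi(alpha) is either zero or
    equal to d (z - alpha)^n P(z) with n >= 2 and P(alpha) = 1
    ([series_on_factor]), and the level set of Re phi through alpha contains at
    least three disjoint arcs issuing from alpha ([sector_root]).  The map c f
    sends them into a vertical line.  But three arcs with a common end cannot be
    mapped continuously and injectively into a line: two of them leave the image
    of alpha on the same side, and by the intermediate value theorem they share
    a value ([no_three_arms]).

    _The computation_ ([halley_map_jet]).  Near alpha all the functions of the
    method are rational expressions in derivatives of h and g and in their
    conjugates.  The Wirtinger derivative d/dz is a derivation for which the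
    conjugates are constants, so the values at alpha of a function and of its
    first three z-derivatives (its [jet]) follow the rules of Leibniz.  Write
    J, J', J'' for the derivatives of J at alpha, and put
    m = h'' g' - g'' h',  e = conj h'' h' - conj g'' g'.
    Because f(alpha) = 0, the jets at alpha are
      f: (0, h', h'', h'''),  conj f: (0, g', g'', g'''),
      N: (0, J, J', J''),  conj N: (0, 0, m, .),  N/J: (0, 1, -J'/J, .),
      A: (0, J, J', J'' - 3/2 (m/J) e),
      B: (J, J'/2, J'^2/(2J) - (m/J) e/2, .).
    So A' = B and A'' = 2 B' at alpha, which gives A/B the jet (0, 1, 0, q) with
    J q = A''' - 3 B''.  The terms in m e cancel and
    q = J''/J - 3/2 (J'/J)^2.  This is the harmonic Schwarzian derivative, since
    d/dz log |J| = J'/J whatever the sign of J ([harmonic_schwarzian_jet]). *)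

(** * Discs and complex derivatives *)

Lemma locally_Cmod (z : C) (P : C -> Prop) :
  locally z P <-> exists rho : R, 0 < rho /\ forall w : C, Cmod (w - z) < rho -> P w.
Proof.
  split.
  - intros [eps H]. exists eps. split; [apply cond_pos|].
    intros w Hw. apply H.
    exact (C_NormedModule_mixin_compat1 z w eps Hw).
  - intros [rho [Hrho H]].
    assert (Hs : 0 < sqrt 2) by (apply sqrt_lt_R0; lra).
    assert (He : 0 < rho / sqrt 2) by (apply Rdiv_lt_0_compat; lra).
    exists (mkposreal _ He). intros w Hw. apply H.
    replace rho with (sqrt 2 * (mkposreal _ He)) by (simpl; field; lra).
    exact (C_NormedModule_mixin_compat2 z w (mkposreal _ He) Hw).
Qed.

Lemma Cmod_center (alpha : C) (rho : R) : 0 < rho -> Cmod (alpha - alpha) < rho.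
Proof. intros H. replace (alpha - alpha)%C with (RtoC 0) by ring. now rewrite Cmod_0. Qed.

Lemma Cmod_ball_open (alpha z : C) (rho : R) :
  Cmod (z - alpha) < rho -> locally z (fun w => Cmod (w - alpha) < rho).
Proof.
  intros H. apply locally_Cmod. exists (rho - Cmod (z - alpha)). split; [lra|].
  intros w Hw. replace (w - alpha)%C with ((w - z) + (z - alpha))%C by ring.
  eapply Rle_lt_trans; [apply Cmod_triangle|]. lra.
Qed.

Lemma im_le_Cmod (c : C) : Rabs (Im c) <= Cmod c.
Proof. eapply Rle_trans; [apply Rmax_r | apply Rmax_Cmod]. Qed.

Lemma Cmod_le_Re_Im (c : C) : Cmod c <= Rabs (Re c) + Rabs (Im c).
Proof.
  replace c with (RtoC (Re c) + Ci * Im c)%C at 1.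
  - eapply Rle_trans; [apply Cmod_triangle|]. rewrite Cmod_mult, Cmod_Ci, !Cmod_R. lra.
  - destruct c as [x y]. unfold RtoC, Ci, Cmult, Cplus; simpl. f_equal; ring.
Qed.

Lemma C_eq_Re_Im (z w : C) : Re z = Re w -> Im z = Im w -> z = w.
Proof. destruct z, w; simpl. now intros -> ->. Qed.

Lemma Cconj_RtoC (x : R) : Cconj (RtoC x) = RtoC x.
Proof. unfold Cconj, RtoC; simpl. f_equal. ring. Qed.

Lemma is_derive_of_bound (f : C -> C) (z l : C) (K rho : R) :
  0 < rho ->
  (forall w : C, Cmod (w - z) < rho ->
     Cmod (f w - f z - (w - z) * l) <= K * Cmod (w - z) ^ 2) ->
  @is_derive C_AbsRing C_NormedModule f z l.
Proof.
  intros Hrho HK. split.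
  - apply is_linear_scal_l.
  - intros x Hx.
    apply (@is_filter_lim_locally_unique C_AbsRing (AbsRing_NormedModule C_AbsRing)) in Hx.
    subst x.
    intros eps.
    assert (Hd : 0 < Rmin rho (eps / (Rabs K + 1))).
    { apply Rmin_pos; trivial. apply Rdiv_lt_0_compat; [apply cond_pos|].
      pose proof (Rabs_pos K); lra. }
    exists (mkposreal _ Hd). intros w Hw.
    change (Cmod (w - z) < Rmin rho (eps / (Rabs K + 1))) in Hw.
    change (Cmod (f w - f z - (w - z) * l) <= eps * Cmod (w - z)).
    eapply Rle_trans.
    { apply HK. apply Rlt_le_trans with (1 := Hw). apply Rmin_l. }
    assert (H0 := Cmod_ge_0 (w - z)).
    assert (H1 : Cmod (w - z) * (Rabs K + 1) <= eps).
    { pose proof (Rabs_pos K).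
      apply Rmult_le_reg_r with (/ (Rabs K + 1)).
      - apply Rinv_0_lt_compat; lra.
      - rewrite Rmult_assoc, Rinv_r, Rmult_1_r by lra.
        left; apply Rlt_le_trans with (1 := Hw), Rmin_r. }
    pose proof (Rle_abs K). simpl. rewrite Rmult_1_r.
    replace (K * (Cmod (w - z) * Cmod (w - z)))
      with ((Cmod (w - z) * K) * Cmod (w - z)) by ring.
    apply Rmult_le_compat_r; trivial. nra.
Qed.

Lemma is_derive_Cmod (f : C -> C) (z l : C) (eps : R) :
  @is_derive C_AbsRing C_NormedModule f z l -> 0 < eps ->
  exists rho : R, 0 < rho /\ forall w : C, Cmod (w - z) < rho ->
     Cmod (f w - f z - (w - z) * l) <= eps * Cmod (w - z).
Proof.
  intros [_ H] Heps.
  destruct (H z (fun P HP => HP) (mkposreal eps Heps)) as [rho Hrho].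
  exists rho. split; [apply cond_pos|]. intros w Hw. exact (Hrho w Hw).
Qed.

(** * Power series of a complex variable *)

(** The radius need not be the radius of convergence: all the statements about
    one point alpha are made on a disc on which h and g are both sums of their
    series. *)
Definition series_on (a : nat -> C) (z0 : C) (r : R) (f : C -> C) : Prop :=
  forall z : C, Cmod (z - z0) < r ->
    @is_pseries C_AbsRing C_NormedModule a (z - z0)%C (f z).

Lemma series_on_small (a : nat -> C) (z0 : C) (r r' : R) (f : C -> C) :
  series_on a z0 r f -> r' <= r -> series_on a z0 r' f.
Proof. intros Hf Hr z Hz. apply Hf. lra. Qed.

Lemma pow_n_Cpow (x : C) (n : nat) : @pow_n C_Ring x n = (x ^ n)%C.
Proof. induction n as [|n IH]; simpl; [reflexivity|]. rewrite IH. reflexivity. Qed.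

Lemma is_pseries_Cpow (a : nat -> C) (x l : C) :
  @is_pseries C_AbsRing C_NormedModule a x l <->
  @is_series C_AbsRing C_NormedModule (fun n => x ^ n * a n)%C l.
Proof.
  split; intros H; eapply is_series_ext; try exact H; intros n; simpl;
  change (@scal C_AbsRing C_NormedModule) with Cmult;
  now rewrite <- (pow_n_Cpow x n).
Qed.

Lemma Cmod_series_le (a : nat -> C) (b : nat -> R) (l : C) (s : R) :
  @is_series C_AbsRing C_NormedModule a l ->
  (forall n, Cmod (a n) <= b n) -> is_series b s -> Cmod l <= s.
Proof.
  intros Ha Hab Hb.
  assert (H1 : is_lim_seq (fun n => Cmod (@sum_n C_NormedModule a n)) (Cmod l)).
  { apply (filterlim_comp _ _ _ (fun n => @sum_n C_NormedModule a n)
             (@norm C_AbsRing C_NormedModule) eventually (locally l)).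
    - exact Ha.
    - apply (@filterlim_norm C_AbsRing C_NormedModule). }
  refine (is_lim_seq_le _ _ (Cmod l) s _ H1 Hb).
  intros n. induction n as [|n IH].
  - rewrite !sum_O. apply Hab.
  - rewrite !sum_Sn. eapply Rle_trans; [apply Cmod_triangle|].
    apply Rplus_le_compat; [exact IH | apply Hab].
Qed.

Lemma ex_series_Cmod (a : nat -> C) (b : nat -> R) :
  (forall n, Cmod (a n) <= b n) -> ex_series b ->
  exists l : C, @is_series C_AbsRing C_NormedModule a l.
Proof.
  intros H Hb.
  exact (@ex_series_le C_AbsRing C_CompleteNormedModule a b H Hb).
Qed.

(** Convergence at a point of modulus between rho and r bounds the terms of the
    series there, whence the real power series of the moduli converges beyond
    rho.  Through it the real theory of radii of convergence applies. *)
Lemma series_on_radius (a : nat -> C) (z0 : C) (r : R) (f : C -> C) (rho : R) :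
  series_on a z0 r f -> 0 <= rho < r ->
  Rbar_lt (Rabs rho) (CV_radius (fun n => Cmod (a n))).
Proof.
  intros Hf Hr. rewrite Rabs_pos_eq by lra.
  set (s := (rho + r) / 2).
  apply Rbar_lt_le_trans with (Finite s); [simpl; unfold s; lra|].
  apply (proj1 (CV_radius_bounded (fun n => Cmod (a n)))).
  assert (Hs : Cmod ((z0 + s) - z0) = s).
  { replace (z0 + s - z0)%C with (RtoC s) by ring.
    rewrite Cmod_R. apply Rabs_pos_eq. unfold s; lra. }
  assert (H := Hf (z0 + s)%C). rewrite Hs in H.
  specialize (H ltac:(unfold s; lra)). apply (proj1 (is_pseries_Cpow _ _ _)) in H.
  destruct (@filterlim_bounded C_AbsRing C_NormedModule _ (ex_intro _ _ H)) as [M HM].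
  assert (HM' : forall n, Cmod (@sum_n C_NormedModule (fun n => ((z0 + s - z0) ^ n * a n)%C)
      n) <= M)
    by exact HM.
  exists (2 * M). intros n.
  replace (Cmod (a n) * s ^ n) with (Cmod ((z0 + s - z0) ^ n * a n)%C)
    by (rewrite Cmod_mult, Cmod_pow, Hs; ring).
  rewrite Rabs_pos_eq by apply Cmod_ge_0.
  destruct n as [|n].
  - specialize (HM' 0%nat). rewrite sum_O in HM'.
    pose proof (Cmod_ge_0 ((z0 + s - z0) ^ 0 * a 0%nat)). lra.
  - assert (H1 := HM' n). specialize (HM' (S n)). rewrite sum_Sn in HM'.
    set (S := @sum_n C_NormedModule (fun n => ((z0 + s - z0) ^ n * a n)%C) n) in *.
    set (t := ((z0 + s - z0) ^ Datatypes.S n * a (Datatypes.S n))%C) in *.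
    change (Cmod (S + t) <= M) in HM'.
    replace t with ((S + t) + - S)%C by ring.
    eapply Rle_trans; [apply Cmod_triangle|]. rewrite Cmod_opp. lra.
Qed.

Lemma ex_series_Cmod_radius (a : nat -> C) (rho : R) :
  0 <= rho -> Rbar_lt (Rabs rho) (CV_radius (fun n => Cmod (a n))) ->
  ex_series (fun n => Cmod (a n) * rho ^ n).
Proof.
  intros Hrho H. apply ex_series_ext with (fun n => Rabs (Cmod (a n) * rho ^ n)).
  - intros n. apply Rabs_pos_eq, Rmult_le_pos; [apply Cmod_ge_0 | now apply pow_le].
  - now apply CV_disk_inside.
Qed.

Lemma ex_pseries_radius (a : nat -> C) (w : C) :
  Rbar_lt (Rabs (Cmod w)) (CV_radius (fun n => Cmod (a n))) ->
  exists l : C, @is_pseries C_AbsRing C_NormedModule a w l.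
Proof.
  intros H. apply ex_series_Cmod_radius in H; [|apply Cmod_ge_0].
  destruct (ex_series_Cmod (fun n => w ^ n * a n)%C _
              (fun n => Req_le _ _ (eq_refl (Cmod (w ^ n * a n)%C)))) as [l Hl].
  - eapply ex_series_ext; [|exact H]. intros n. simpl.
    rewrite Cmod_mult, Cmod_pow. apply Rmult_comm.
  - exists l. now apply is_pseries_Cpow.
Qed.

Definition CPS_derive (a : nat -> C) (n : nat) : C := (INR (S n) * a (S n))%C.

Lemma Cmod_CPS_derive (a : nat -> C) (n : nat) :
  Cmod (CPS_derive a n) = PS_derive (fun k => Cmod (a k)) n.
Proof.
  unfold CPS_derive, PS_derive.
  now rewrite Cmod_mult, Cmod_R, Rabs_pos_eq by apply pos_INR.
Qed.

Lemma CV_radius_CPS_derive (a : nat -> C) :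
  CV_radius (fun n => Cmod (CPS_derive a n)) = CV_radius (fun n => Cmod (a n)).
Proof.
  rewrite <- (CV_radius_derive (fun n => Cmod (a n))).
  apply CV_radius_ext, Cmod_CPS_derive.
Qed.

Lemma Cpow_diff_bound (w u : C) (rho : R) (n : nat) :
  Cmod w <= rho -> Cmod u <= rho ->
  Cmod (u ^ S n - w ^ S n) <= INR (S n) * rho ^ n * Cmod (u - w).
Proof.
  intros Hw Hu. assert (H0 : 0 <= rho) by (pose proof (Cmod_ge_0 w); lra).
  induction n as [|n IH].
  - replace (u ^ 1 - w ^ 1)%C with (u - w)%C by (simpl; ring). simpl. lra.
  - replace (u ^ S (S n) - w ^ S (S n))%C
      with (w * (u ^ S n - w ^ S n) + (u - w) * u ^ S n)%C by (simpl; ring).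
    eapply Rle_trans; [apply Cmod_triangle|]. rewrite !Cmod_mult, Cmod_pow.
    assert (H1 : Cmod u ^ S n <= rho ^ S n)
      by (apply pow_incr; split; [apply Cmod_ge_0 | exact Hu]).
    pose proof (Cmod_ge_0 w). pose proof (Cmod_ge_0 (u - w)).
    pose proof (Cmod_ge_0 (u ^ S n - w ^ S n)).
    apply Rle_trans with (rho * (INR (S n) * rho ^ n * Cmod (u - w)) + Cmod (u - w)
        * rho ^ S n).
    + apply Rplus_le_compat; [now apply Rmult_le_compat | now apply Rmult_le_compat_l].
    + rewrite (S_INR (S n)). simpl pow. apply Req_le. ring.
Qed.

(** Summed against the coefficients, the right-hand side is the second derivative
    of the series of moduli: this is what makes the remainder of the
    termwise derivative quadratic. *)
Lemma Cpow_taylor_bound (w u : C) (rho : R) (n : nat) :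
  Cmod w <= rho -> Cmod u <= rho ->
  Cmod (u ^ S (S n) - w ^ S (S n) - (u - w) * (INR (S (S n)) * w ^ S n))
    <= INR (S n) * INR (S (S n)) * rho ^ n * Cmod (u - w) ^ 2.
Proof.
  intros Hw Hu. assert (H0 : 0 <= rho) by (pose proof (Cmod_ge_0 w); lra).
  pose proof (Cmod_ge_0 (u - w)) as Hd.
  induction n as [|n IH].
  - replace (u ^ 2 - w ^ 2 - (u - w) * (INR 2 * w ^ 1))%C with ((u - w) * (u - w))%C.
    + rewrite Cmod_mult. simpl. nra.
    + replace (INR 2) with 2 by (simpl; ring). simpl. ring.
  - replace (u ^ S (S (S n)) - w ^ S (S (S n)) - (u - w) * (INR (S (S (S n))) * w ^ S (S n)))%C
      with (w * (u ^ S (S n) - w ^ S (S n) - (u - w) * (INR (S (S n)) * w ^ S n))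
            + (u - w) * (u ^ S (S n) - w ^ S (S n)))%C.
    2:{ rewrite (S_INR (S (S n))), RtoC_plus. simpl Cpow. ring. }
    eapply Rle_trans; [apply Cmod_triangle|]. rewrite !(Cmod_mult w), !(Cmod_mult (u - w)).
    pose proof (Cpow_diff_bound w u rho (S n) Hw Hu) as H1.
    pose proof (Cmod_ge_0 w).
    set (A := Cmod (u ^ S (S n) - w ^ S (S n) - (u - w) * (INR (S (S n)) * w ^ S n))) in *.
    assert (HA : 0 <= A) by apply Cmod_ge_0.
    eapply Rle_trans.
    { apply Rplus_le_compat; [apply Rmult_le_compat; [| |exact Hw|exact IH]; trivial
                             | apply Rmult_le_compat_l; [exact Hd|exact H1]]. }
    rewrite (S_INR (S (S n))). rewrite (S_INR (S n)).
    simpl pow. set (d := Cmod (u - w)) in *. set (m := INR (S n)).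
    assert (0 <= m) by apply pos_INR.
    assert (0 <= rho * rho ^ n) by (apply (pow_le rho (S n) H0)).
    assert (0 <= rho * rho ^ n * (d * d)) by (apply Rmult_le_pos; nra).
    nra.
Qed.

Lemma series_on_is_derive (a : nat -> C) (z0 : C) (r : R) (f : C -> C) (z : C) :
  series_on a z0 r f -> Cmod (z - z0) < r ->
  exists l : C,
    @is_pseries C_AbsRing C_NormedModule (CPS_derive a) (z - z0)%C l /\
    @is_derive C_AbsRing C_NormedModule f z l.
Proof.
  intros Hf Hz.
  set (rho := (Cmod (z - z0) + r) / 2).
  pose proof (Cmod_ge_0 (z - z0)) as H0.
  assert (Hrho : Cmod (z - z0) < rho < r) by (unfold rho; lra).
  assert (R0 := series_on_radius a z0 r f rho Hf ltac:(lra)).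
  assert (Rz := series_on_radius a z0 r f (Cmod (z - z0)) Hf ltac:(lra)).
  rewrite <- CV_radius_CPS_derive in Rz.
  destruct (ex_pseries_radius _ _ Rz) as [l Hl].
  exists l. split; [exact Hl|].
  rewrite <- CV_radius_CPS_derive, <- CV_radius_CPS_derive in R0.
  apply ex_series_Cmod_radius in R0; [|lra].
  destruct R0 as [K HK].
  apply is_derive_of_bound with (K := K) (rho := rho - Cmod (z - z0)); [lra|].
  intros v Hv.
  assert (Hv0 : Cmod (v - z0) < rho).
  { replace (v - z0)%C with ((v - z) + (z - z0))%C by ring.
    eapply Rle_lt_trans; [apply Cmod_triangle|]. lra. }
  assert (Sv := Hf v ltac:(lra)). assert (Sz := Hf z Hz).
  apply (proj1 (is_pseries_Cpow _ _ _)) in Sv, Sz, Hl.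
  set (u := (v - z0)%C) in *. set (w := (z - z0)%C) in *.
  assert (Hk : (v - z = u - w)%C) by (unfold u, w; ring). rewrite Hk.
  (* The series of the difference quotient, re-indexed so that the constant
     term of f disappears. *)
  assert (S1 : @is_series C_AbsRing C_NormedModule
     (fun n => (u ^ S n - w ^ S n - (u - w) * (INR (S n) * w ^ n)) * a (S n))%C
     (f v - f z - (u - w) * l)%C).
  { apply is_series_ext with (fun n : nat =>
      @minus C_NormedModule
       (@minus C_NormedModule (u ^ S n * a (S n))%C (w ^ S n * a (S n))%C)
       (@scal C_AbsRing C_NormedModule (u - w)%C (w ^ n * CPS_derive a n)%C)).
    { intros n. unfold CPS_derive.
      change ((u ^ S n * a (S n) - w ^ S n * a (S n)) - (u - w) * (w ^ n * (INR (S n)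
          * a (S n)))
        = (u ^ S n - w ^ S n - (u - w) * (INR (S n) * w ^ n)) * a (S n))%C. ring. }
    apply (is_series_minus (V := C_NormedModule)).
    2: now apply (is_series_scal (V := C_NormedModule)).
    replace (f v - f z)%C with (@minus C_NormedModule (f v - u ^ 0 * a 0%nat)%C (f z - w ^ 0
        * a 0%nat)%C).
    2:{ change ((f v - u ^ 0 * a 0%nat) - (f z - w ^ 0 * a 0%nat) = f v - f z)%C. simpl. ring. }
    apply (is_series_minus (V := C_NormedModule)).
    - apply (is_series_incr_1 (V := C_NormedModule) (fun n => u ^ n * a n)%C).
      match goal with |- is_series _ ?x => replace x with (f v) end; [exact Sv|].
      change (f v = (f v - u ^ 0 * a 0%nat) + (u ^ 0 * a 0%nat))%C. ring.
    - apply (is_series_incr_1 (V := C_NormedModule) (fun n => w ^ n * a n)%C).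
      match goal with |- is_series _ ?x => replace x with (f z) end; [exact Sz|].
      change (f z = (f z - w ^ 0 * a 0%nat) + (w ^ 0 * a 0%nat))%C. ring. }
  assert (S2 : @is_series C_AbsRing C_NormedModule
     (fun n => (u ^ S (S n) - w ^ S (S n) - (u - w) * (INR (S (S n)) * w ^ S n))
         * a (S (S n)))%C
     (f v - f z - (u - w) * l)%C).
  { apply (is_series_incr_1 (V := C_NormedModule)
      (fun n => (u ^ S n - w ^ S n - (u - w) * (INR (S n) * w ^ n)) * a (S n))%C).
    match goal with |- is_series _ ?x => replace x with (f v - f z - (u - w) * l)%C end;
      [exact S1|].
    match goal with |- _ = plus ?x ?y => change (plus x y) with (x + y)%C end.
    simpl.
    match goal with |- @eq _ ?x ?y => change (@eq C x y) end. ring. }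
  rewrite Rmult_comm.
  refine (Cmod_series_le _ _ _ _ S2 _ (is_series_scal_l (Cmod (u - w) ^ 2) _ K HK)).
  intros n. rewrite Cmod_mult, !Cmod_CPS_derive. unfold PS_derive.
  rewrite Cmod_CPS_derive. unfold PS_derive.
  eapply Rle_trans.
  { apply Rmult_le_compat_r; [apply Cmod_ge_0|].
    apply (Cpow_taylor_bound w u rho n); lra. }
  match goal with |- _ <= scal ?x ?y => change (scal x y) with (x * y) end.
  apply Req_le. ring.
Qed.

Lemma series_on_derive (a : nat -> C) (z0 : C) (r : R) (f : C -> C) :
  series_on a z0 r f -> series_on (CPS_derive a) z0 r (C_derive f).
Proof.
  intros Hf z Hz. destruct (series_on_is_derive a z0 r f z Hf Hz) as [l [H1 H2]].
  now rewrite (is_C_derive_unique f z l H2).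
Qed.

Lemma series_on_C_derive (a : nat -> C) (z0 : C) (r : R) (f : C -> C) (z : C) :
  series_on a z0 r f -> Cmod (z - z0) < r ->
  @is_derive C_AbsRing C_NormedModule f z (C_derive f z).
Proof.
  intros Hf Hz. destruct (series_on_is_derive a z0 r f z Hf Hz) as [l [H1 H2]].
  now rewrite (is_C_derive_unique f z l H2).
Qed.

Lemma series_on_center (a : nat -> C) (z0 : C) (r : R) (f : C -> C) :
  series_on a z0 r f -> 0 < r -> f z0 = a 0%nat.
Proof.
  intros Hf Hr. assert (E : (z0 - z0 = 0)%C) by ring.
  assert (H := Hf z0). rewrite E, Cmod_0 in H. specialize (H Hr).
  apply (@filterlim_locally_unique nat C_AbsRing C_NormedModule eventually _ _ _ _ H).
  exact (@is_pseries_0 C_AbsRing C_NormedModule a).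
Qed.

Lemma series_on_C_derive_center (a : nat -> C) (z0 : C) (r : R) (f : C -> C) :
  series_on a z0 r f -> 0 < r -> C_derive f z0 = a 1%nat.
Proof.
  intros Hf Hr. rewrite (series_on_center _ _ _ _ (series_on_derive _ _ _ _ Hf) Hr).
  unfold CPS_derive. change (INR 1) with 1. ring.
Qed.

Lemma series_on_lin (c d : C) (a b : nat -> C) (z0 : C) (r : R) (f g : C -> C) :
  series_on a z0 r f -> series_on b z0 r g ->
  series_on (fun n => c * a n + d * b n)%C z0 r (fun z => c * f z + d * g z)%C.
Proof.
  intros Hf Hg z Hz.
  assert (Sf := proj1 (is_pseries_Cpow _ _ _) (Hf z Hz)).
  assert (Sg := proj1 (is_pseries_Cpow _ _ _) (Hg z Hz)).
  apply (proj2 (is_pseries_Cpow _ _ _)).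
  refine (is_series_ext _ _ _ _ (is_series_plus (V := C_NormedModule) _ _ _ _
    (is_series_scal (V := C_NormedModule) c _ _ Sf) (is_series_scal (V := C_NormedModule)
        d _ _ Sg))).
  intros n. change (c * ((z - z0) ^ n * a n) + d * ((z - z0) ^ n * b n)
    = (z - z0) ^ n * (c * a n + d * b n))%C. ring.
Qed.

(** The quotient is again a power series, on the same disc: its value at the
    centre is the one that the shifted series prescribes. *)
Lemma series_on_factor (d : nat -> C) (z0 : C) (r : R) (f : C -> C) (n : nat) :
  0 < r -> (0 < n)%nat -> series_on d z0 r f ->
  (forall k, (0 < k < n)%nat -> d k = RtoC 0) -> d n <> RtoC 0 ->
  exists (b : nat -> C) (P : C -> C), series_on b z0 r P /\ P z0 = RtoC 1 /\
    forall z, Cmod (z - z0) < r -> (f z - f z0 = d n * (z - z0) ^ n * P z)%C.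
Proof.
  intros Hr Hn Hf Hd Hdn.
  set (P := fun z : C => if Ceq_dec z z0 then RtoC 1 else
     ((f z - f z0) / (d n * (z - z0) ^ n))%C).
  exists (fun k => d (n + k)%nat / d n)%C, P.
  assert (H0 := series_on_center d z0 r f Hf Hr).
  assert (Hpow : forall z, z <> z0 -> ((z - z0) ^ n)%C <> RtoC 0).
  { intros z Hz. apply Cpow_nz. intros E. apply Hz. now apply Ceq_minus. }
  split; [|split].
  - intros z Hz. unfold P. destruct (Ceq_dec z z0) as [-> | Hne].
    + replace (RtoC 1) with (d (n + 0)%nat / d n)%C
        by (rewrite Nat.add_0_r; field; exact Hdn).
      replace (z0 - z0)%C with (@zero C_Ring) by (change (RtoC 0 = z0 - z0)%C; ring).
      exact (@is_pseries_0 C_AbsRing C_NormedModule (fun k => d (n + k)%nat / d n)%C).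
    + specialize (Hpow z Hne).
      assert (Hz0 : (z - z0)%C <> RtoC 0) by (intros E; apply Hne; now apply Ceq_minus).
      assert (S := Hf z Hz).
      assert (S' := @is_pseries_decr_n C_AbsRing C_NormedModule d n (z - z0)%C (/ (z - z0))%C
          (f z)
         (Cinv_l _ Hz0) Hn S).
      assert (Hsum : @sum_n C_NormedModule (fun k => scal (@pow_n C_Ring (z - z0)%C k) (d k))
          (n - 1) = f z0).
      { rewrite H0. clear -Hn Hd. destruct n as [|n]; [lia|].
        replace (S n - 1)%nat with n by lia. clear Hn. induction n as [|n IH].
        - rewrite sum_O. change (@pow_n C_Ring (z - z0)%C 0) with (RtoC 1).
          change (1 * d 0%nat = d 0%nat)%C. ring.
        - rewrite sum_Sn, IH by (intros k Hk; apply Hd; lia). rewrite (Hd (S n)) by lia.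
          match goal with |- plus ?x (scal ?y ?t) = _ => change (x + y * t = x)%C end. ring. }
      match type of S' with is_pseries _ _ (scal _ (plus _ (opp ?t))) =>
        replace t with (f z0) in S' by (symmetry; exact Hsum) end.
      apply (proj1 (is_pseries_Cpow _ _ _)) in S'. apply (proj2 (is_pseries_Cpow _ _ _)).
      assert (S'' := is_series_scal (V := C_NormedModule) (/ d n)%C _ _ S').
      eapply is_series_ext in S''.
      1: match type of S'' with is_series _ ?l =>
         replace ((f z - f z0) / (d n * (z - z0) ^ n))%C with l; [exact S''|] end.
      * rewrite pow_n_Cpow. change (/ d n * ((/ (z - z0)) ^ n * (f z - f z0)) = (f z - f z0)
          / (d n * (z - z0) ^ n))%C.
        rewrite Cpow_inv by exact Hz0. field. split; assumption.
      * intros k. unfold PS_decr_n. change (/ d n * ((z - z0) ^ k * d (n + k)%nat) = (z - z0)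
          ^ k * (d (n + k)%nat / d n))%C.
        unfold Cdiv. ring.
  - unfold P. destruct (Ceq_dec z0 z0); congruence.
  - intros z Hz. unfold P. destruct (Ceq_dec z z0) as [-> | Hne].
    + replace (z0 - z0)%C with (RtoC 0) by ring.
      destruct n as [|n]; [lia|]. simpl. ring.
    + specialize (Hpow z Hne). field. split; assumption.
Qed.

Lemma series_on_const (d : nat -> C) (z0 : C) (r : R) (f : C -> C) (z : C) :
  series_on d z0 r f -> (forall k, (0 < k)%nat -> d k = RtoC 0) ->
  Cmod (z - z0) < r -> f z = f z0.
Proof.
  intros Hf Hd Hz. assert (Hr : 0 < r) by (pose proof (Cmod_ge_0 (z - z0)); lra).
  rewrite (series_on_center d z0 r f Hf Hr).
  apply (@filterlim_locally_unique nat C_AbsRing C_NormedModule eventually _ _ _ _ (Hf z Hz)).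
  apply filterlim_ext with (fun _ => d 0%nat); [|apply filterlim_const].
  intros n. induction n as [|n IH].
  - rewrite sum_O. change (d 0%nat = 1 * d 0%nat)%C. ring.
  - rewrite sum_Sn, <- IH, (Hd (S n)) by lia.
    match goal with |- _ = plus ?x (scal ?y ?t) => change (x = x + y * t)%C end. ring.
Qed.

Lemma least_nonzero (d : nat -> C) :
  (forall k, (0 < k)%nat -> d k = RtoC 0) \/
  exists n, (0 < n)%nat /\ d n <> RtoC 0 /\ forall k, (0 < k < n)%nat -> d k = RtoC 0.
Proof.
  destruct (classic (exists n, (0 < n)%nat /\ d n <> RtoC 0)) as [[n Hn]|H].
  - right. revert Hn. induction n as [n IH]
      using (well_founded_induction PeanoNat.Nat.lt_wf_0). intros [Hn Hd].
    destruct (classic (exists k, (k < n)%nat /\ (0 < k)%nat /\ d k <> RtoC 0))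
        as [[k [Hk Hk']]|Hno].
    + exact (IH k Hk Hk').
    + exists n. repeat split; trivial. intros k Hk. apply NNPP. intros E. apply Hno.
    exists k. tauto.
  - left. intros k Hk. apply NNPP. intros E. apply H. now exists k.
Qed.

(** * Real gradients and the Wirtinger derivative *)

Local Instance C_filter (z : C) : Filter (@locally C_UniformSpace z) :=
  @filter_filter _ _ (locally_filter z).

(** Differentiability in the real sense, with gradient (a, b). Partial
    derivatives alone would give neither the chain rule nor continuity. *)
Definition is_grad (u : C -> R) (z : C) (a b : R) : Prop :=
  @filterdiff R_AbsRing C_R_NormedModule R_NormedModule u (@locally C_UniformSpace z)
    (fun v : C => a * fst v + b * snd v).

Lemma is_grad_ext_loc (u v : C -> R) (z : C) (a b : R) :
  locally z (fun w => u w = v w) -> is_grad u z a b -> is_grad v z a b.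
Proof.
  intros H Hu. refine (@filterdiff_ext_loc R_AbsRing C_R_NormedModule R_NormedModule
      (@locally C_UniformSpace z) (C_filter z) u v _ H _ Hu).
  intros x Hx. apply (@is_filter_lim_locally_unique R_AbsRing C_R_NormedModule) in Hx. subst x.
  exact (locally_singleton z _ H).
Qed.

Lemma is_grad_const (c : R) (z : C) : is_grad (fun _ => c) z 0 0.
Proof.
  refine (@filterdiff_ext_lin R_AbsRing C_R_NormedModule R_NormedModule (@locally
      C_UniformSpace z) (C_filter z)
      _ _ _ (@filterdiff_const R_AbsRing C_R_NormedModule R_NormedModule (@locally
      C_UniformSpace z) (C_filter z) c) _).
  intros v. change (0 = 0 * fst v + 0 * snd v). ring.
Qed.

Lemma is_grad_plus (u v : C -> R) (z : C) (a b a' b' : R) :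
  is_grad u z a b -> is_grad v z a' b' ->
  is_grad (fun w => u w + v w) z (a + a') (b + b').
Proof.
  intros Hu Hv. refine (@filterdiff_ext_lin R_AbsRing C_R_NormedModule R_NormedModule
      (@locally C_UniformSpace z) (C_filter z)
      _ _ _ (@filterdiff_plus_fct R_AbsRing C_R_NormedModule R_NormedModule (@locally
      C_UniformSpace z) (C_filter z) u v _ _ Hu Hv) _).
  intros w. change ((a * fst w + b * snd w) + (a' * fst w + b' * snd w)
     = (a + a') * fst w + (b + b') * snd w). ring.
Qed.

Lemma is_grad_mult (u v : C -> R) (z : C) (a b a' b' : R) :
  is_grad u z a b -> is_grad v z a' b' ->
  is_grad (fun w => u w * v w) z (a * v z + u z * a') (b * v z + u z * b').
Proof.
  intros Hu Hv.
  refine (@filterdiff_ext_lin R_AbsRing C_R_NormedModule R_NormedModule (@locally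
      C_UniformSpace z) (C_filter z)
      _ _ _ (@filterdiff_mult_fct R_AbsRing C_R_NormedModule u v z _ _ Rmult_comm Hu Hv) _).
  intros w. change ((a * fst w + b * snd w) * v z + u z * (a' * fst w + b' * snd w)
     = (a * v z + u z * a') * fst w + (b * v z + u z * b') * snd w). ring.
Qed.

Lemma is_grad_comp (phi : R -> R) (u : C -> R) (z : C) (a b l : R) :
  is_derive phi (u z) l -> is_grad u z a b ->
  is_grad (fun w => phi (u w)) z (l * a) (l * b).
Proof.
  intros Hphi Hu.
  refine (@filterdiff_ext_lin R_AbsRing C_R_NormedModule R_NormedModule (@locally
      C_UniformSpace z) (C_filter z)
      _ _ _ (@filterdiff_comp' R_AbsRing C_R_NormedModule R_NormedModule R_NormedModule u phi
      z _ _ Hu Hphi) _).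
  intros w. change ((a * fst w + b * snd w) * l = l * a * fst w + l * b * snd w). ring.
Qed.

Lemma is_grad_curve (u : C -> R) (x y : R -> R) (t a b x' y' : R) :
  is_grad u (x t, y t) a b -> is_derive x t x' -> is_derive y t y' ->
  is_derive (fun s => u (x s, y s)) t (a * x' + b * y').
Proof.
  intros Hu Hx Hy.
  refine (filterdiff_ext_lin _ _ _
    (@filterdiff_comp'_2 R_AbsRing R_NormedModule R_NormedModule R_NormedModule R_NormedModule
       x y (fun p q => u (p, q)) t _ _ (fun p q => a * p + b * q) Hx Hy _) _).
  - refine (@filterdiff_ext R_AbsRing C_R_NormedModule R_NormedModule
      (@locally C_UniformSpace (x t, y t)) (C_filter _) u _ _ _ Hu).
    intros [p q]; reflexivity.
  - intros s. change (a * (s * x') + b * (s * y') = s * (a * x' + b * y')). ring.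
Qed.

Lemma is_grad_continuous (u : C -> R) (z : C) (a b : R) :
  is_grad u z a b -> @continuous C_UniformSpace R_UniformSpace u z.
Proof.
  intros H.
  apply (@filterdiff_continuous R_AbsRing C_R_NormedModule R_NormedModule u z).
  eexists. exact H.
Qed.

Lemma C_R_norm (v : C) : @norm R_AbsRing C_R_NormedModule v = Cmod v.
Proof.
  unfold norm; simpl. unfold prod_norm, Cmod. simpl. f_equal.
  unfold norm; simpl. unfold abs; simpl.
  rewrite !Rmult_1_r, <- !Rabs_mult, !Rabs_pos_eq; try nra.
Qed.

Lemma is_linear_grad (a b : R) :
  @is_linear R_AbsRing C_R_NormedModule R_NormedModule (fun v : C => a * fst v + b * snd v).
Proof.
  split.
  - intros [x y] [x' y'].
    change (a * (x + x') + b * (y + y') = (a * x + b * y) + (a * x' + b * y')). ring.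
  - intros k [x y]. change (a * (k * x) + b * (k * y) = k * (a * x + b * y)). ring.
  - exists (Rabs a + Rabs b + 1). pose proof (Rabs_pos a). pose proof (Rabs_pos b).
    split; [lra|]. intros v. rewrite C_R_norm.
    change (Rabs (a * Re v + b * Im v) <= (Rabs a + Rabs b + 1) * Cmod v).
    eapply Rle_trans; [apply Rabs_triang|]. rewrite !Rabs_mult.
    pose proof (re_le_Cmod v). pose proof (im_le_Cmod v). pose proof (Cmod_ge_0 v). nra.
Qed.

Lemma is_grad_intro (u : C -> R) (z : C) (a b : R) :
  (forall eps : R, 0 < eps -> exists rho : R, 0 < rho /\ forall w : C, Cmod (w - z) < rho ->
     Rabs (u w - u z - (a * Re (w - z) + b * Im (w - z))) <= eps * Cmod (w - z)) ->
  is_grad u z a b.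
Proof.
  intros H. split; [apply is_linear_grad|].
  intros x Hx. apply (@is_filter_lim_locally_unique R_AbsRing C_R_NormedModule) in Hx. subst x.
  intros eps. destruct (H eps (cond_pos eps)) as [rho [Hrho HK]].
  apply locally_Cmod. exists rho. split; [exact Hrho|]. intros w Hw.
  rewrite C_R_norm. exact (HK w Hw).
Qed.

(** The Cauchy-Riemann equations. *)
Lemma is_derive_grad (f : C -> C) (z l : C) :
  @is_derive C_AbsRing C_NormedModule f z l ->
  is_grad (fun w => Re (f w)) z (Re l) (- Im l) /\
  is_grad (fun w => Im (f w)) z (Im l) (Re l).
Proof.
  intros H; split; apply is_grad_intro; intros eps Heps;
  destruct (is_derive_Cmod f z l eps H Heps) as [rho [Hrho HK]];
  exists rho; split; trivial; intros w Hw; (eapply Rle_trans; [|exact (HK w Hw)]).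
  - eapply Rle_trans; [|apply re_le_Cmod]. apply Req_le. f_equal.
    destruct (f w), (f z), w, z, l; simpl; ring.
  - eapply Rle_trans; [|apply im_le_Cmod]. apply Req_le. f_equal.
    destruct (f w), (f z), w, z, l; simpl; ring.
Qed.

Definition is_Dz (F : C -> C) (z d : C) : Prop :=
  exists a b a' b' : R,
    is_grad (fun w => Re (F w)) z a b /\ is_grad (fun w => Im (F w)) z a' b' /\
    d = (/ 2 * ((a, a') - Ci * (b, b')))%C.

Lemma is_derive_C_pair (x y : R -> R) (t x' y' : R) :
  is_derive x t x' -> is_derive y t y' ->
  @is_derive R_AbsRing C_R_NormedModule (fun s => (x s, y s)) t (x', y').
Proof.
  intros Hx Hy.
  refine (@filterdiff_ext_lin R_AbsRing R_NormedModule C_R_NormedModule _ _ _ _ _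
    (@filterdiff_comp'_2 R_AbsRing R_NormedModule R_NormedModule R_NormedModule
        C_R_NormedModule x y (fun p q => (p, q)) t _ _ (fun p q => (p, q)) Hx Hy _) _).
  - apply filterdiff_ext with (fun p : prod_NormedModule _ R_NormedModule R_NormedModule => p).
    { intros [p q]; reflexivity. }
    refine (filterdiff_ext_lin _ _ _ (filterdiff_id _) _). intros [p q]; reflexivity.
  - intros s. reflexivity.
Qed.

(** The partial derivatives are the derivatives along the horizontal and the
    vertical line through z. *)
Lemma is_Dz_correct (F : C -> C) (z d : C) : is_Dz F z d -> ex_Dz F z /\ Dz F z = d.
Proof.
  intros (a & b & a' & b' & H1 & H2 & ->). destruct z as [x y].
  assert (X1 := is_grad_curve _ (fun s => s) (fun _ => y) x a b 1 0 H1 (is_derive_id x)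
      (is_derive_const y x)).
  assert (X2 := is_grad_curve _ (fun s => s) (fun _ => y) x a' b' 1 0 H2 (is_derive_id x)
      (is_derive_const y x)).
  assert (Y1 := is_grad_curve _ (fun _ => x) (fun s => s) y a b 0 1 H1 (is_derive_const x y)
      (is_derive_id y)).
  assert (Y2 := is_grad_curve _ (fun _ => x) (fun s => s)
      y a' b' 0 1 H2 (is_derive_const x y) (is_derive_id y)).
  split; [split|].
  - exists (a * 1 + b * 0, a' * 1 + b' * 0).
    refine (is_derive_ext _ _ _ _ _ (is_derive_C_pair _ _ _ _ _ X1 X2)).
    intros s. symmetry. exact (surjective_pairing (F (s, y))).
  - exists (a * 0 + b * 1, a' * 0 + b' * 1).
    refine (is_derive_ext _ _ _ _ _ (is_derive_C_pair _ _ _ _ _ Y1 Y2)).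
    intros s. symmetry. exact (surjective_pairing (F (x, s))).
  - unfold Dz, Defs.Dx, Defs.Dy.
    apply is_derive_unique in X1, X2, Y1, Y2. simpl in *. rewrite X1, X2, Y1, Y2.
    rewrite !Rmult_0_r, !Rmult_1_r, !Rplus_0_r, !Rplus_0_l. reflexivity.
Qed.

Lemma is_Dz_ext_loc (F G : C -> C) (z d : C) :
  locally z (fun w => F w = G w) -> is_Dz F z d -> is_Dz G z d.
Proof.
  intros H (a & b & a' & b' & H1 & H2 & Hd). exists a, b, a', b'.
  split; [|split; [|exact Hd]].
  - refine (is_grad_ext_loc (fun w => Re (F w)) _ z _ _ _ H1).
    exact (filter_imp _ _ (fun w (E : F w = G w) => f_equal Re E) H).
  - refine (is_grad_ext_loc (fun w => Im (F w)) _ z _ _ _ H2).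
    exact (filter_imp _ _ (fun w (E : F w = G w) => f_equal Im E) H).
Qed.

Lemma is_Dz_ext_ball (rho : R) (alpha : C) (F G : C -> C) (z d : C) :
  (forall w, Cmod (w - alpha) < rho -> F w = G w) -> Cmod (z - alpha) < rho ->
  is_Dz F z d -> is_Dz G z d.
Proof.
  intros H Hz. apply is_Dz_ext_loc.
  exact (filter_imp _ _ H (Cmod_ball_open alpha z rho Hz)).
Qed.

Lemma is_Dz_eq (F : C -> C) (z d d' : C) : is_Dz F z d -> d = d' -> is_Dz F z d'.
Proof. now intros H <-. Qed.

Lemma is_Dz_continuous (F : C -> C) (z d : C) (eps : R) :
  is_Dz F z d -> 0 < eps -> locally z (fun w => Cmod (F w - F z) < eps).
Proof.
  intros (a & b & a' & b' & H1 & H2 & _) Heps.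
  apply is_grad_continuous in H1, H2.
  assert (He : 0 < eps / 2) by lra.
  assert (L1 : locally z (fun w => Rabs (Re (F w) - Re (F z)) < eps / 2))
    by exact (H1 _ (locally_ball (Re (F z)) (mkposreal _ He))).
  assert (L2 : locally z (fun w => Rabs (Im (F w) - Im (F z)) < eps / 2))
    by exact (H2 _ (locally_ball (Im (F z)) (mkposreal _ He))).
  refine (filter_imp _ _ _ (filter_and _ _ L1 L2)). intros w [B1 B2].
  eapply Rle_lt_trans; [apply Cmod_le_Re_Im|].
  change (Rabs (Re (F w) - Re (F z)) + Rabs (Im (F w) - Im (F z)) < eps). lra.
Qed.

Lemma is_Dz_const (c z : C) : is_Dz (fun _ => c) z 0.
Proof.
  exists 0, 0, 0, 0. split; [apply is_grad_const|split; [apply is_grad_const|]].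
  change (0, 0) with (RtoC 0). ring.
Qed.

Lemma is_Dz_plus (F G : C -> C) (z d e : C) :
  is_Dz F z d -> is_Dz G z e -> is_Dz (fun w => F w + G w)%C z (d + e).
Proof.
  intros (a & b & a' & b' & H1 & H2 & ->) (p & q & p' & q' & K1 & K2 & ->).
  exists (a + p), (b + q), (a' + p'), (b' + q'). split; [|split].
  - exact (is_grad_plus _ _ _ _ _ _ _ H1 K1).
  - exact (is_grad_plus _ _ _ _ _ _ _ H2 K2).
  - change (a + p, a' + p') with ((a, a') + (p, p'))%C.
    change (b + q, b' + q') with ((b, b') + (q, q'))%C. ring.
Qed.

Lemma is_Dz_mult (F G : C -> C) (z d e : C) :
  is_Dz F z d -> is_Dz G z e ->
  is_Dz (fun w => F w * G w)%C z (d * G z + F z * e).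
Proof.
  intros (a & b & a' & b' & H1 & H2 & ->) (p & q & p' & q' & K1 & K2 & ->).
  assert (Hopp : forall u x y, is_grad u z x y ->
      is_grad (fun w => - u w) z (- 1 * x) (- 1 * y)).
  { intros u x y Hu. eapply is_grad_comp; [|exact Hu]. auto_derive; trivial; ring. }
  eexists _, _, _, _. split; [|split].
  - exact (is_grad_plus _ _ _ _ _ _ _ (is_grad_mult _ _ _ _ _ _ _ H1 K1)
       (Hopp _ _ _ (is_grad_mult _ _ _ _ _ _ _ H2 K2))).
  - exact (is_grad_plus _ _ _ _ _ _ _ (is_grad_mult _ _ _ _ _ _ _ H1 K2)
       (is_grad_mult _ _ _ _ _ _ _ H2 K1)).
  - cbv beta. destruct (F z) as [x y], (G z) as [x' y'].
    unfold Cmult, Cplus, Cminus, Copp, Ci, RtoC, Cinv; simpl. f_equal; field.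
Qed.

Lemma is_Dz_inv (F : C -> C) (z d : C) :
  F z <> 0 -> is_Dz F z d -> is_Dz (fun w => / F w)%C z (- d / (F z * F z)).
Proof.
  intros Hz (a & b & a' & b' & H1 & H2 & ->).
  assert (Hm : Re (F z) * Re (F z) + Im (F z) * Im (F z) <> 0).
  { intros E. apply Hz. destruct (F z) as [x y]; simpl in *.
    assert (x = 0) by nra. assert (y = 0) by nra. subst. reflexivity. }
  assert (Hn := is_grad_plus _ _ _ _ _ _ _ (is_grad_mult _ _ _ _ _ _ _ H1 H1)
                  (is_grad_mult _ _ _ _ _ _ _ H2 H2)).
  assert (Hi : is_derive Rinv (Re (F z) * Re (F z) + Im (F z) * Im (F z))
     (- / ((Re (F z) * Re (F z) + Im (F z) * Im (F z)) * (Re (F z) * Re (F z) + Im (F z)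
         * Im (F z))))).
  { auto_derive; trivial. field. exact Hm. }
  assert (Hq := is_grad_comp _ _ _ _ _ _ Hi Hn). cbv beta in Hq.
  assert (H3 : is_grad (fun w => - Im (F w)) z (-1 * a') (-1 * b')).
  { eapply is_grad_comp; [|exact H2]. auto_derive; trivial; ring. }
  eexists _, _, _, _. split; [|split].
  - refine (is_grad_ext_loc _ _ _ _ _ _ (is_grad_mult _ _ _ _ _ _ _ H1 Hq)).
    apply filter_forall. intros w. unfold Cinv, Rdiv; simpl. now rewrite !Rmult_1_r.
  - refine (is_grad_ext_loc _ _ _ _ _ _ (is_grad_mult _ _ _ _ _ _ _ H3 Hq)).
    apply filter_forall. intros w. unfold Cinv, Rdiv; simpl. now rewrite !Rmult_1_r.
  - cbv beta. destruct (F z) as [x y]. simpl in Hm |- *.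
    assert (Hm2 : (x * x - y * y) * (x * x - y * y) + (x * y + y * x) * (x * y + y * x) <> 0).
    { replace ((x * x - y * y) * (x * x - y * y) + (x * y + y * x) * (x * y + y * x))
       with ((x * x + y * y) * (x * x + y * y)) by ring.
       now apply Rmult_integral_contrapositive. }
    unfold Cdiv, Cmult, Cplus, Cminus, Copp, Ci, RtoC, Cinv; simpl.
    f_equal; field; repeat split; trivial; lra.
Qed.

Lemma is_Dz_holo (f : C -> C) (z l : C) :
  @is_derive C_AbsRing C_NormedModule f z l -> is_Dz f z l.
Proof.
  intros H. destruct (is_derive_grad f z l H) as [H1 H2].
  eexists _, _, _, _. split; [|split]; [exact H1|exact H2|].
  destruct l; unfold Cmult, Cplus, Cminus, Copp, Ci, RtoC, Cinv; simpl. f_equal; field.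
Qed.

Lemma is_Dz_antiholo (f : C -> C) (z l : C) :
  @is_derive C_AbsRing C_NormedModule f z l -> is_Dz (fun w => Cconj (f w)) z 0.
Proof.
  intros H. destruct (is_derive_grad f z l H) as [H1 H2].
  assert (H3 : is_grad (fun w => - Im (f w)) z (-1 * Im l) (-1 * Re l)).
  { eapply is_grad_comp; [|exact H2]. auto_derive; trivial; ring. }
  eexists _, _, _, _. split; [|split]; [exact H1|exact H3|].
  destruct l; unfold Cmult, Cplus, Cminus, Copp, Ci, RtoC, Cinv; simpl. f_equal; field.
Qed.

Lemma is_Dz_ln (u : C -> R) (z d : C) :
  0 < u z -> is_Dz (fun w => RtoC (u w)) z d ->
  is_Dz (fun w => RtoC (ln (u w))) z (d / u z).
Proof.
  intros Hu (a & b & a' & b' & H1 & H2 & ->).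
  (* The imaginary part is the constant 0, which may be scaled like the real part. *)
  exists (/ u z * a), (/ u z * b), (/ u z * a'), (/ u z * b'). split; [|split].
  - eapply is_grad_comp; [|exact H1]. simpl. auto_derive; trivial. field; lra.
  - refine (is_grad_ext_loc (fun _ => / u z * 0) _ _ _ _ _ _).
    { apply filter_forall. intros w; simpl. ring. }
    refine (is_grad_comp (fun x => / u z * x) _ _ _ _ _ _ H2). auto_derive; trivial; ring.
  - unfold Cdiv. rewrite <- RtoC_inv by lra.
    unfold Cmult, Cplus, Cminus, Copp, Ci, RtoC, Cinv; simpl. f_equal; field; lra.
Qed.

(** * Arcs issuing from a point *)

Lemma IVT_closed (u : R -> R) (a b : R) :
  a < b -> (forall t, a <= t <= b -> continuous u t) -> u a < 0 -> 0 < u b ->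
  exists t, a < t < b /\ u t = 0.
Proof.
  intros Hab Hc Ha Hb.
  destruct (Ranalysis5.IVT_interv u a b) as [t [Ht H0]]; trivial.
  { intros s Hs. apply continuity_pt_filterlim. now apply Hc. }
  exists t. split; [|exact H0].
  destruct (Req_dec t a) as [->|Hta]; [lra|]. destruct (Req_dec t b) as [->|Htb]; [lra|]. lra.
Qed.

Lemma common_value (v w : R -> R) (T : R) :
  0 < T -> (forall t, 0 <= t <= T -> continuous v t) ->
  (forall t, 0 <= t <= T -> continuous w t) -> v 0 = 0 -> w 0 = 0 ->
  0 < v T -> 0 < w T ->
  exists s t, 0 < s <= T /\ 0 < t <= T /\ v s = w t.
Proof.
  intros HT Hv Hw Hv0 Hw0 HvT HwT.
  assert (Hshift : forall u y, (forall t, 0 <= t <= T -> continuous u t) ->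
     u 0 = 0 -> 0 < y -> y < u T -> exists t, 0 < t <= T /\ u t = y).
  { intros u y Hu Hu0 Hy HuT.
    destruct (IVT_closed (fun t => u t - y) 0 T) as [t [Ht H]]; trivial.
    - intros t Ht. apply (continuous_minus (V := R_NormedModule)).
      now apply Hu. apply continuous_const.
    - lra.
    - lra.
    - exists t. split; lra. }
  destruct (Rtotal_order (v T) (w T)) as [H | [H | H]].
  - destruct (Hshift w (v T)) as [t [Ht E]]; trivial. exists T, t. repeat split; lra.
  - exists T, T. repeat split; lra.
  - destruct (Hshift v (w T)) as [t [Ht E]]; trivial. exists t, T. repeat split; lra.
Qed.

Definition cis (t : R) : C := (cos t, sin t).

Lemma cis_plus (s t : R) : cis (s + t) = (cis s * cis t)%C.
Proof.
  unfold cis, Cmult; simpl. rewrite cos_plus, sin_plus. f_equal. ring.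
Qed.

Lemma cis_pow (t : R) (n : nat) : (cis t ^ n)%C = cis (INR n * t).
Proof.
  induction n as [|n IH].
  - simpl. unfold cis. now rewrite Rmult_0_l, cos_0, sin_0.
  - rewrite S_INR, Cpow_S, IH, <- cis_plus. f_equal. ring.
Qed.

Lemma Cmod_cis (t : R) : Cmod (cis t) = 1.
Proof.
  unfold Cmod, cis; simpl. rewrite !Rmult_1_r. rewrite Rplus_comm.
  change (sqrt (Rsqr (sin t) + Rsqr (cos t)) = 1). rewrite sin2_cos2. apply sqrt_1.
Qed.

Lemma cos_lt_1 (x : R) : 0 < x < 2 * PI -> cos x < 1.
Proof.
  intros H. replace x with (2 * (x / 2)) by field. rewrite cos_2a_sin.
  assert (0 < sin (x / 2)) by (apply sin_gt_0; lra). nra.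
Qed.

Lemma polar_inj (s t a b : R) :
  0 < s -> 0 < t -> (s * cis a)%C = (t * cis b)%C -> ~ 0 < a - b < 2 * PI.
Proof.
  intros Hs Ht E H. apply cos_lt_1 in H.
  assert (Est : s = t).
  { assert (E' := f_equal Cmod E). rewrite !Cmod_mult, !Cmod_cis, !Cmod_R in E'.
    rewrite !Rabs_pos_eq in E' by lra. lra. }
  subst t. assert (E1 := f_equal Re E). assert (E2 := f_equal Im E).
  simpl in E1, E2. assert (cos a = cos b) by nra. assert (sin a = sin b) by nra.
  rewrite cos_minus, H0, H1 in H. pose proof (sin2_cos2 b) as K. unfold Rsqr in K. lra.
Qed.

Lemma polar_form (z : C) : exists t : R, z = (Cmod z * cis t)%C.
Proof.
  destruct (Ceq_dec z 0) as [-> | Hz].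
  - exists 0. rewrite Cmod_0. ring.
  - assert (Hm : 0 < Cmod z) by now apply Cmod_gt_0.
    set (x := Re z / Cmod z). set (y := Im z / Cmod z).
    assert (Hxy : x * x + y * y = 1).
    { unfold x, y. pose proof (Cmod2_alt z) as E. simpl in E. rewrite !Rmult_1_r in E.
      field_simplify; [|lra]. simpl. rewrite !Rmult_1_r, <- E. field. lra. }
    assert (Hs : exists t, cos t = x /\ sin t = y).
    { assert (-1 <= x <= 1) by nra.
      assert (Hc := cos_acos x H). assert (Hsn := sin_acos x H).
      replace (1 - x ^ 2) with (Rsqr y) in Hsn by (unfold Rsqr; simpl; lra).
      replace (1 - x²) with (Rsqr y) in Hsn by (unfold Rsqr; simpl; lra).
      rewrite sqrt_Rsqr_abs in Hsn.
      destruct (Rle_dec 0 y).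
      - exists (acos x). rewrite Rabs_pos_eq in Hsn; auto.
      - exists (- acos x). rewrite cos_neg, sin_neg. rewrite Rabs_left in Hsn by lra.
        split; [exact Hc | lra]. }
    destruct Hs as [t [Hc Hsn]]. exists t. unfold cis. rewrite Hc, Hsn.
    destruct z as [p q]. unfold x, y. set (m := Cmod (p, q)) in *.
    unfold RtoC, Cmult; simpl. f_equal; field; lra.
Qed.

(** Parametrised by the distance to alpha, so that an arc is given by its polar
    angle th. *)
Definition arm (alpha : C) (th : R -> R) (t : R) : C := (alpha + t * cis (th t))%C.

Lemma Cmod_arm (alpha : C) (th : R -> R) (t : R) : Cmod (arm alpha th t - alpha) = Rabs t.
Proof.
  unfold arm. replace (alpha + t * cis (th t) - alpha)%C with (t * cis (th t))%C by ring.
  rewrite Cmod_mult, Cmod_R, Cmod_cis. ring.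
Qed.

Lemma continuous_pair_C (x y : R -> R) (t : R) :
  continuous x t -> continuous y t ->
  @continuous R_UniformSpace C_UniformSpace (fun s => (x s, y s)) t.
Proof.
  intros Hx Hy.
  apply (@continuous_comp_2 R_UniformSpace R_UniformSpace R_UniformSpace C_UniformSpace
    x y (fun p q => (p, q)) t Hx Hy).
  apply continuous_ext with (fun p : prod_UniformSpace R_UniformSpace R_UniformSpace => p).
  - intros [p q]; reflexivity.
  - apply continuous_id.
Qed.

Lemma continuous_arm (alpha : C) (th : R -> R) (t : R) :
  continuous th t -> @continuous R_UniformSpace C_UniformSpace (arm alpha th) t.
Proof.
  intros H.
  apply (@continuous_ext R_UniformSpace C_UniformSpace
    (fun s => (fst alpha + s * cos (th s), snd alpha + s * sin (th s)))).
  { intros s. unfold arm, cis, Cplus, Cmult, RtoC; simpl. f_equal; ring. }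
  apply continuous_pair_C.
  - apply (continuous_plus (V := R_NormedModule)); [apply continuous_const|].
    apply (continuous_mult (K := R_AbsRing)); [apply continuous_id|].
    apply (continuous_comp th cos); [exact H | apply continuous_cos].
  - apply (continuous_plus (V := R_NormedModule)); [apply continuous_const|].
    apply (continuous_mult (K := R_AbsRing)); [apply continuous_id|].
    apply (continuous_comp th sin); [exact H | apply continuous_sin].
Qed.

(** At t = 0 the angle may jump; continuity there comes from the distance to
    alpha, which is |t|. *)
Lemma continuous_on_arm (V : C -> R) (alpha : C) (th : R -> R) (t0 : R) :
  (forall z, Cmod (z - alpha) < t0 -> @continuous C_UniformSpace R_UniformSpace V z) ->
  (forall t, 0 < t < t0 -> continuous th t) ->
  forall t, 0 <= t < t0 -> continuous (fun s => V (arm alpha th s)) t.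
Proof.
  intros HV Hth t Ht.
  destruct (Req_dec t 0) as [-> | Ht0].
  - assert (E : arm alpha th 0 = alpha) by (unfold arm; ring).
    apply (@continuous_comp R_UniformSpace C_UniformSpace R_UniformSpace).
    2: { rewrite E. apply HV. replace (alpha - alpha)%C with (RtoC 0) by ring.
    rewrite Cmod_0. lra. }
    intros P HP. rewrite E in HP. apply locally_Cmod in HP. destruct HP as [rho [Hrho HP]].
    exists (mkposreal rho Hrho). intros s Hs. apply HP. rewrite Cmod_arm.
    change (Rabs (s - 0) < rho) in Hs. now rewrite Rminus_0_r in Hs.
  - apply (@continuous_comp R_UniformSpace C_UniformSpace R_UniformSpace).
    + apply continuous_arm, Hth. lra.
    + apply HV. rewrite Cmod_arm, Rabs_pos_eq by lra. lra.
Qed.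

(** Each of the three arms leaves alpha on one side of the value V(alpha), so two
    of them leave it on the same side and take a common value. *)
Lemma no_three_arms (V : C -> R) (alpha : C) (th : nat -> R -> R) (t0 : R) :
  0 < t0 ->
  (forall z, Cmod (z - alpha) < t0 -> @continuous C_UniformSpace R_UniformSpace V z) ->
  (forall k t, (k < 3)%nat -> 0 < t < t0 -> continuous (th k) t) ->
  (forall j k s t, (j < k)%nat -> (k < 3)%nat -> 0 < s < t0 -> 0 < t < t0 ->
     0 < th k t - th j s < 2 * PI) ->
  (forall k t, (k < 3)%nat -> 0 < t < t0 -> V (arm alpha (th k) t) <> V alpha) ->
  (forall j k s t, (j < 3)%nat -> (k < 3)%nat -> 0 < s < t0 -> 0 < t < t0 ->
     V (arm alpha (th j) s) = V (arm alpha (th k) t) ->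
     arm alpha (th j) s = arm alpha (th k) t) ->
  False.
Proof.
  intros Ht0 HV Hth Hsep Hne Hinj.
  (* eps = 1 or -1 tells the side of V alpha. *)
  assert (Hsame : forall eps j k, eps * eps = 1 -> (j < k)%nat -> (k < 3)%nat ->
    0 < eps * (V (arm alpha (th j) (t0 / 2)) - V alpha) ->
    0 < eps * (V (arm alpha (th k) (t0 / 2)) - V alpha) -> False).
  { intros eps j k Heps Hjk Hk Hj0 Hk0.
    assert (Hcont : forall i, (i < 3)%nat -> forall t, 0 <= t <= t0 / 2 ->
      continuous (fun s => eps * (V (arm alpha (th i) s) - V alpha)) t).
    { intros i Hi t Ht.
      apply (continuous_scal_r (V := R_NormedModule) eps).
      apply (continuous_minus (V := R_NormedModule)); [|apply continuous_const].
      apply (continuous_on_arm V alpha (th i) t0); auto. lra. }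
    assert (Hz : forall i, eps * (V (arm alpha (th i) 0) - V alpha) = 0).
    { intros i. replace (arm alpha (th i) 0) with alpha by (unfold arm; ring). ring. }
    destruct (common_value _ _ (t0 / 2) ltac:(lra) (Hcont j ltac:(lia)) (Hcont k ltac:(lia))
      (Hz j) (Hz k) Hj0 Hk0) as [s [t [Hs [Ht E]]]].
    assert (E' : V (arm alpha (th j) s) = V (arm alpha (th k) t)).
    { apply (f_equal (Rmult eps)) in E. rewrite <- !Rmult_assoc, Heps in E. lra. }
    apply Hinj in E'; try lia; try lra.
    unfold arm in E'. apply (f_equal (fun z => z - alpha)%C) in E'.
    apply (polar_inj t s (th k t) (th j s)); [lra | lra | | apply Hsep; trivial; lra].
    transitivity (alpha + t * cis (th k t) - alpha)%C; [ring|]. rewrite <- E'. ring. }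
  assert (H0 := Hne 0%nat (t0 / 2) ltac:(lia) ltac:(lra)).
  assert (H1 := Hne 1%nat (t0 / 2) ltac:(lia) ltac:(lra)).
  assert (H2 := Hne 2%nat (t0 / 2) ltac:(lia) ltac:(lra)).
  pose proof (fun j k => Hsame 1 j k ltac:(lra)) as Hp.
  pose proof (fun j k => Hsame (-1) j k ltac:(lra)) as Hm.
  pose proof (Hp 0%nat 1%nat ltac:(lia) ltac:(lia)).
  pose proof (Hp 0%nat 2%nat ltac:(lia) ltac:(lia)).
  pose proof (Hp 1%nat 2%nat ltac:(lia) ltac:(lia)).
  pose proof (Hm 0%nat 1%nat ltac:(lia) ltac:(lia)).
  pose proof (Hm 0%nat 2%nat ltac:(lia) ltac:(lia)).
  pose proof (Hm 1%nat 2%nat ltac:(lia) ltac:(lia)).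
  clear Hsame Hp Hm.
  destruct (Rtotal_order (V (arm alpha (th 0%nat) (t0 / 2))) (V alpha)) as [K0|[K0|K0]];
  destruct (Rtotal_order (V (arm alpha (th 1%nat) (t0 / 2))) (V alpha)) as [K1|[K1|K1]];
  destruct (Rtotal_order (V (arm alpha (th 2%nat) (t0 / 2))) (V alpha)) as [K2|[K2|K2]];
  lra.
Qed.

(** Monotonicity in x gives a single root, and the signs of G next to that root
    persist for nearby t, which makes the root continuous. *)
Lemma implicit_root (G : R -> R -> R) (a b t0 : R) :
  a < b ->
  (forall t x, 0 < t < t0 -> a <= x <= b -> continuous (G t) x) ->
  (forall t x, 0 < t < t0 -> a <= x <= b -> continuous (fun s => G s x) t) ->
  (forall t x y, 0 < t < t0 -> a <= x -> x < y -> y <= b -> G t x < G t y) ->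
  (forall t, 0 < t < t0 -> G t a < 0 < G t b) ->
  exists xi : R -> R, forall t, 0 < t < t0 ->
    a <= xi t <= b /\ G t (xi t) = 0 /\ continuous xi t.
Proof.
  intros Hab Hx Ht Hmono Hends.
  assert (Hex : forall t, exists x, 0 < t < t0 -> a < x < b /\ G t x = 0).
  { intros t. destruct (classic (0 < t < t0)) as [H|H].
    - destruct (IVT_closed (G t) a b) as [x Hroot]; auto; try apply Hends; auto.
      now exists x.
    - exists a. tauto. }
  apply functional_choice in Hex. destruct Hex as [xi Hxi].
  exists xi. intros t Htt. destruct (Hxi t Htt) as [Hin Hroot].
  split; [lra|]. split; [exact Hroot|].
  apply filterlim_locally. intros eps.
  set (x1 := Rmax a (xi t - eps / 2)). set (x2 := Rmin b (xi t + eps / 2)).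
  pose proof (cond_pos eps) as Heps.
  assert (Hx1 : a <= x1 < xi t /\ xi t - eps < x1).
  { unfold x1. pose proof (Rmax_l a (xi t - eps / 2)). pose proof (Rmax_r a (xi t - eps / 2)).
    repeat split; try lra. apply Rmax_lub_lt; lra. }
  assert (Hx2 : xi t < x2 <= b /\ x2 < xi t + eps).
  { unfold x2. pose proof (Rmin_l b (xi t + eps / 2)). pose proof (Rmin_r b (xi t + eps / 2)).
    repeat split; try lra. apply Rmin_glb_lt; lra. }
  assert (G1 : G t x1 < 0) by (rewrite <- Hroot; apply Hmono; lra).
  assert (G2 : 0 < G t x2) by (rewrite <- Hroot; apply Hmono; lra).
  assert (L1 : locally t (fun s => G s x1 < 0)).
  { apply (Ht t x1 Htt ltac:(lra) (fun y => y < 0)). apply open_lt. exact G1. }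
  assert (L2 : locally t (fun s => 0 < G s x2)).
  { apply (Ht t x2 Htt ltac:(lra) (fun y => 0 < y)). apply open_gt. exact G2. }
  assert (L3 : locally t (fun s => 0 < s < t0)).
  { apply filter_and; [apply open_gt | apply open_lt]; lra. }
  generalize (filter_and _ _ L1 (filter_and _ _ L2 L3)). apply filter_imp.
  intros s [S1 [S2 S3]]. destruct (Hxi s S3) as [Hins Hs].
  assert (x1 < xi s).
  { apply Rnot_le_lt. intros [Hlt|Heq].
    - assert (K := Hmono s (xi s) x1 S3 ltac:(lra) Hlt ltac:(lra)). lra.
    - rewrite Heq in Hs. lra. }
  assert (xi s < x2).
  { apply Rnot_le_lt. intros [Hlt|Heq].
    - assert (K := Hmono s x2 (xi s) S3 ltac:(lra) Hlt ltac:(lra)). lra.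
    - rewrite <- Heq in Hs. lra. }
  change (Rabs (xi s - xi t) < eps). apply Rabs_def1; lra.
Qed.

(** * Lewy's theorem *)

(** When d cis(c) is i |d| up to sign, this is, up to the factor |d| t^n and a
    sign, the real part of d (z - alpha)^n P(z) at the point
    z = alpha + t cis ((c + x) / n). *)
Definition sector_fun (P : C -> C) (alpha : C) (n : nat) (c t x : R) : R :=
  Im (cis x * P (arm alpha (fun _ => (c + x) / INR n) t)).

(** For small t the function is close to sin x, uniformly with its derivative in
    x, because P is close to 1 and its derivative is bounded. So it has a single
    zero for |x| <= pi/4. *)
Lemma sector_root (b : nat -> C) (P : C -> C) (alpha : C) (r : R) (n : nat) :
  0 < r -> (0 < n)%nat -> series_on b alpha r P -> P alpha = RtoC 1 ->
  exists t0, 0 < t0 <= r /\ forall c : R, exists xi : R -> R, forall t, 0 < t < t0 ->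
    - (PI / 4) <= xi t <= PI / 4 /\
    sector_fun P alpha n c t (xi t) = 0 /\ continuous xi t.
Proof.
  intros Hr Hn HP HP1.
  assert (HPd := series_on_derive _ _ _ _ HP).
  assert (Hc0 : Cmod (alpha - alpha) < r)
    by (replace (alpha - alpha)%C with (RtoC 0) by ring; now rewrite Cmod_0).
  assert (L1 := is_Dz_continuous P alpha _ (/ 8)
      (is_Dz_holo _ _ _ (series_on_C_derive _ _ _ _ _ HP Hc0)) ltac:(lra)).
  assert (L2 := is_Dz_continuous (C_derive P)
      alpha _ 1 (is_Dz_holo _ _ _ (series_on_C_derive _ _ _ _ _ HPd Hc0)) ltac:(lra)).
  set (M := Cmod (C_derive P alpha) + 1).
  assert (HM : 1 <= M) by (pose proof (Cmod_ge_0 (C_derive P alpha)); unfold M; lra).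
  destruct (proj1 (locally_Cmod _ _) (filter_and _ _ L1 L2)) as [rho [Hrho HL]].
  (* M bounds the derivative of P, so for t <= 1/(16 M) the derivative of P along
     the circle of radius t is at most 1/8 in each component. *)
  exists (Rmin (Rmin r rho) (/ (16 * M))).
  assert (HM16 : 0 < / (16 * M)) by (apply Rinv_0_lt_compat; lra).
  set (t0 := Rmin (Rmin r rho) (/ (16 * M))).
  assert (Ht0 : 0 < t0 <= r /\ t0 <= rho /\ t0 <= / (16 * M)).
  { unfold t0. pose proof (Rmin_l (Rmin r rho) (/ (16 * M))).
  pose proof (Rmin_r (Rmin r rho) (/ (16 * M))).
    pose proof (Rmin_l r rho). pose proof (Rmin_r r rho).
    repeat split; try lra. repeat apply Rmin_pos; trivial. }
  split; [tauto|]. intros c.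
  set (w := fun t x => arm alpha (fun _ => (c + x) / INR n) t).
  assert (Hn0 : 1 <= INR n) by (change 1 with (INR 1); apply le_INR; lia).
  assert (Hw : forall t x, 0 < t < t0 -> Cmod (w t x - alpha) = t).
  { intros t x Ht. unfold w. rewrite Cmod_arm. apply Rabs_pos_eq. lra. }
  assert (Hre : forall t x, 0 < t < t0 ->
      Rabs (Re (P (w t x)) - 1) <= / 8 /\ Rabs (Im (P (w t x))) <= / 8).
  { intros t x Ht. destruct (HL (w t x)) as [K _]; [rewrite Hw by lra; lra|].
    rewrite HP1 in K. split.
    - eapply Rle_trans; [|left; exact K]. eapply Rle_trans; [|apply re_le_Cmod].
      apply Req_le. reflexivity.
    - eapply Rle_trans; [|left; exact K]. eapply Rle_trans; [|apply im_le_Cmod].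
      apply Req_le. f_equal.
      unfold Cminus. rewrite im_plus, im_opp, im_RtoC. ring. }
  assert (Hder : forall t x, 0 < t < t0 -> exists u' v' : R,
     is_derive (fun y => Re (P (w t y))) x u' /\ is_derive (fun y => Im (P (w t y))) x v' /\
     Rabs u' <= / 8 /\ Rabs v' <= / 8).
  { intros t x Ht.
    assert (Hwr : Cmod (w t x - alpha) < r) by (rewrite Hw by lra; lra).
    destruct (is_derive_grad P (w t x) _ (series_on_C_derive _ _ _ _ _ HP Hwr)) as [G1 G2].
    assert (Hl : Cmod (C_derive P (w t x)) <= M).
    { destruct (HL (w t x)) as [_ K]; [rewrite Hw by lra; lra|].
      replace (C_derive P (w t x)) with ((C_derive P (w t x) - C_derive P alpha)
          + C_derive P alpha)%C by ring.
      eapply Rle_trans; [apply Cmod_triangle|]. unfold M. lra. }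
    set (l := C_derive P (w t x)) in *.
    assert (Ew : forall y, w t y = (fst alpha + t * cos ((c + y) / INR n),
        snd alpha + t * sin ((c + y) / INR n))).
    { intros y. unfold w, arm, cis, Cplus, Cmult, RtoC; simpl. f_equal; ring. }
    set (X := fun y => fst alpha + t * cos ((c + y) / INR n)).
    set (Y := fun y => snd alpha + t * sin ((c + y) / INR n)).
    set (p := - (t / INR n) * sin ((c + x) / INR n)).
    set (q := (t / INR n) * cos ((c + x) / INR n)).
    assert (HX : is_derive X x p) by (unfold X, p, Rdiv; auto_derive; [trivial | ring]).
    assert (HY : is_derive Y x q) by (unfold Y, q, Rdiv; auto_derive; [trivial | ring]).
    rewrite Ew in G1, G2.
    assert (D1 := is_grad_curve _ X Y x _ _ _ _ G1 HX HY).
    assert (D2 := is_grad_curve _ X Y x _ _ _ _ G2 HX HY).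
    assert (Htn : 0 <= t / INR n <= t).
    { split; [apply Rle_div_r; lra|]. apply Rle_div_l; nra. }
    assert (Hpq : Rabs p <= t /\ Rabs q <= t).
    { unfold p, q. rewrite !Rabs_mult, Rabs_Ropp, (Rabs_pos_eq (t / INR n)) by lra.
      pose proof (SIN_bound ((c + x) / INR n)). pose proof (COS_bound ((c + x) / INR n)).
      assert (Rabs (sin ((c + x) / INR n)) <= 1) by (apply Rabs_le; lra).
      assert (Rabs (cos ((c + x) / INR n)) <= 1) by (apply Rabs_le; lra).
      pose proof (Rabs_pos (sin ((c + x) / INR n))).
      pose proof (Rabs_pos (cos ((c + x) / INR n))). split; nra. }
    assert (HMt : M * t <= / 16).
    { apply Rle_trans with (M * / (16 * M)); [apply Rmult_le_compat_l; lra|]. apply Req_le.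
    field. lra. }
    pose proof (re_le_Cmod l) as Hlr. pose proof (im_le_Cmod l) as Hli.
    assert (Hprod : forall x y, Rabs x <= Cmod l -> Rabs y <= t -> Rabs (x * y) <= / 16).
    { intros x' y' Hx' Hy'. rewrite Rabs_mult. eapply Rle_trans; [|exact HMt].
      apply Rmult_le_compat; try apply Rabs_pos; lra. }
    assert (Hlo : Rabs (- Im l) <= Cmod l) by (now rewrite Rabs_Ropp).
    eexists _, _. split; [|split; [|split]].
    - refine (is_derive_ext _ _ _ _ _ D1). intros y. rewrite Ew. reflexivity.
    - refine (is_derive_ext _ _ _ _ _ D2). intros y. rewrite Ew. reflexivity.
    - eapply Rle_trans; [apply Rabs_triang|].
      pose proof (Hprod (Re l) p Hlr (proj1 Hpq)).
      pose proof (Hprod (- Im l) q Hlo (proj2 Hpq)). lra.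
    - eapply Rle_trans; [apply Rabs_triang|].
      pose proof (Hprod (Im l) p Hli (proj1 Hpq)).
      pose proof (Hprod (Re l) q Hlr (proj2 Hpq)). lra. }
  assert (Hs2 : 7 / 10 < / sqrt 2).
  { pose proof (sqrt_sqrt 2 ltac:(lra)). assert (0 < sqrt 2) by (apply sqrt_lt_R0; lra).
    apply Rmult_lt_reg_r with (sqrt 2); trivial. rewrite Rinv_l by lra. nra. }
  pose proof PI_RGT_0 as Hpi.
  assert (Hcos : forall x, - (PI / 4) <= x <= PI / 4 -> 7 / 10 < cos x).
  { intros x Hx. apply Rlt_le_trans with (cos (PI / 4)).
    - rewrite cos_PI4. unfold Rdiv at 2. rewrite Rmult_1_l. exact Hs2.
    - destruct (Rle_dec 0 x).
      + apply cos_decr_1; lra.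
      + rewrite <- (cos_neg x). apply cos_decr_1; lra. }
  assert (Eg : forall t x, sector_fun P alpha n c t x = cos x * Im (P (w t x))
      + sin x * Re (P (w t x))).
  { intros t x. reflexivity. }
  assert (HG : forall t x, 0 < t < t0 -> exists g',
     is_derive (sector_fun P alpha n c t) x g' /\ (- (PI / 4) <= x <= PI / 4 -> 0 < g')).
  { intros t x Ht. destruct (Hder t x Ht) as (u' & v' & D1 & D2 & B1 & B2).
    destruct (Hre t x Ht) as [B3 B4].
    exists ((- sin x * Im (P (w t x)) + cos x * v') + (cos x * Re (P (w t x)) + sin x * u')).
    split.
    - apply (is_derive_plus (V := R_NormedModule)).
      + apply (is_derive_mult cos (fun y => Im (P (w t y))) x (- sin x) v'); trivial.
        apply is_derive_cos. exact Rmult_comm.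
      + apply (is_derive_mult sin (fun y => Re (P (w t y))) x (cos x) u'); trivial.
        apply is_derive_sin. exact Rmult_comm.
    - intros Hx. specialize (Hcos x Hx).
      pose proof (SIN_bound x). pose proof (COS_bound x).
      apply Rabs_le_between in B1, B2, B3, B4.
      set (u := Re (P (w t x))) in *. set (v := Im (P (w t x))) in *.
      set (S := sin x) in *. set (K := cos x) in *.
      assert (E1 : - / 8 <= - S * v) by nra. assert (E2 : - / 8 <= K * v') by nra.
      assert (E3 : - / 8 <= S * u') by nra. assert (E4 : 7 / 10 * (7 / 8) <= K * u) by nra.
      lra. }
  destruct (implicit_root (sector_fun P alpha n c) (- (PI / 4)) (PI / 4) t0) as [xi Hxi].
  - lra.
  - intros t x Ht _. destruct (HG t x Ht) as [g' [D _]].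
    apply (ex_derive_continuous (V := R_NormedModule)). now exists g'.
  - intros t x Ht _.
    assert (Hwr : Cmod (w t x - alpha) < r) by (rewrite Hw by lra; lra).
    destruct (is_derive_grad P (w t x) _ (series_on_C_derive _ _ _ _ _ HP Hwr)) as [G1 G2].
    assert (Cw : @continuous R_UniformSpace C_UniformSpace (fun s => w s x) t)
      by (apply continuous_arm, continuous_const).
    apply (continuous_plus (V := R_NormedModule) (fun s => cos x * Im (P (w s x)))
        (fun s => sin x * Re (P (w s x)))).
    + apply (continuous_scal_r (V := R_NormedModule) (cos x)).
      apply (@continuous_comp R_UniformSpace C_UniformSpace R_UniformSpace (fun s => w s x)
          (fun z => Im (P z)) t Cw).
      exact (is_grad_continuous _ _ _ _ G2).
    + apply (continuous_scal_r (V := R_NormedModule) (sin x)).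
      apply (@continuous_comp R_UniformSpace C_UniformSpace R_UniformSpace (fun s => w s x)
          (fun z => Re (P z)) t Cw).
      exact (is_grad_continuous _ _ _ _ G1).
  - intros t x y Ht Hx Hxy Hy.
    assert (Hd : forall s, exists g',
        is_derive (sector_fun P alpha n c t) s g' /\ (- (PI / 4) <= s <= PI / 4 -> 0 < g'))
      by (intros s; now apply HG).
    apply functional_choice in Hd. destruct Hd as [g' Hg'].
    destruct (MVT_gen (sector_fun P alpha n c t) x y g') as [s [Hs E]].
    + intros s _. apply Hg'.
    + intros s _. apply continuity_pt_filterlim.
      apply (ex_derive_continuous (V := R_NormedModule)). eexists. apply Hg'.
    + rewrite Rmin_left, Rmax_right in Hs by lra.
      pose proof (proj2 (Hg' s) ltac:(lra)). nra.
  - intros t Ht. rewrite !Eg, cos_neg, sin_neg, cos_PI4, sin_PI4.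
    unfold Rdiv; rewrite !Rmult_1_l.
    destruct (Hre t (- (PI * / 4)) Ht) as [B1 B2]. destruct (Hre t (PI * / 4) Ht) as [B3 B4].
    apply Rabs_le_between in B1, B2, B3, B4. split; nra.
  - exists xi. exact Hxi.
Qed.

(** For c = i (conj a + b) the two terms are i (|a|^2 + a b) and - i (a b + |b|^2).
    When conj a + b = 0, the choice c = conj a gives |a|^2 - |a|^2. *)
Lemma critical_direction (a b : C) :
  Cmod a = Cmod b -> exists c : C, c <> RtoC 0 /\ (c * a + Cconj c * b = 0)%C.
Proof.
  intros H.
  assert (Hab : (a * Cconj a = b * Cconj b)%C) by now rewrite <- !Cmod2_conj, H.
  destruct (Ceq_dec (Cconj a + b) 0) as [E|E].
  - destruct (Ceq_dec a 0) as [-> | Ha].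
    + exists (RtoC 1). split; [apply C1_nz|].
      rewrite Cmod_0 in H. rewrite (Cmod_eq_0 b) by auto. ring.
    + exists (Cconj a). split.
      * intros E'. apply Ha. rewrite <- (Cconj_conj a), E'. unfold Cconj, RtoC; simpl.
      f_equal; ring.
      * rewrite Cconj_conj. replace b with (Cconj a + b - Cconj a)%C by ring. rewrite E. ring.
  - exists (Ci * (Cconj a + b))%C. split; [apply Cmult_neq_0; [apply Ci_nz|exact E]|].
    rewrite Cmult_conj, Cplus_conj, Cconj_conj.
    replace (Cconj Ci) with (- Ci)%C by (unfold Cconj, Ci, Copp; simpl; f_equal; ring).
    replace (Ci * (Cconj a + b) * a + - Ci * (a + Cconj b) * b)%C
      with (Ci * (a * Cconj a - b * Cconj b))%C by ring.
    rewrite Hab. ring.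
Qed.

Lemma Re_conj_swap (c h g : C) : Re (c * (h + Cconj g)) = Re (c * h + Cconj c * g).
Proof. destruct c, h, g; simpl; ring. Qed.

(** A level set of Re phi on which three arms issue from alpha is mapped by c f
    into a line, where the imaginary part of c f is a coordinate. *)
Lemma no_critical_injective (h g phi : C -> C) (c alpha : C) (a b d : nat -> C) (r : R) :
  0 < r -> c <> RtoC 0 ->
  series_on a alpha r h -> series_on b alpha r g -> series_on d alpha r phi ->
      d 1%nat = RtoC 0 ->
  (forall z, Cmod (z - alpha) < r -> Re (c * (h z + Cconj (g z))) = Re (phi z)) ->
  (forall z1 z2, Cmod (z1 - alpha) < r -> Cmod (z2 - alpha) < r ->
     (h z1 + Cconj (g z1) = h z2 + Cconj (g z2))%C -> z1 = z2) ->
  False.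
Proof.
  intros Hr Hc Hh Hg Hphi Hd1 Hre Hinj.
  set (f := fun z => (h z + Cconj (g z))%C).
  set (V := fun z => Im (c * f z)).
  assert (Hcenter : Cmod (alpha - alpha) < r)
    by (replace (alpha - alpha)%C with (RtoC 0) by ring; now rewrite Cmod_0).
  assert (HV : forall z, Cmod (z - alpha) < r -> @continuous C_UniformSpace R_UniformSpace V z).
  { intros z Hz.
    destruct (is_Dz_mult (fun _ => c) f z _ _ (is_Dz_const c z)
      (is_Dz_plus _ _ _ _ _ (is_Dz_holo _ _ _ (series_on_C_derive _ _ _ _ _ Hh Hz))
         (is_Dz_antiholo _ _ _ (series_on_C_derive _ _ _ _ _ Hg Hz))))
             as (? & ? & ? & ? & _ & H & _).
    exact (is_grad_continuous _ _ _ _ H). }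
  assert (HVinj : forall z1 z2, Cmod (z1 - alpha) < r -> Cmod (z2 - alpha) < r ->
    Re (phi z1) = Re (phi alpha) -> Re (phi z2) = Re (phi alpha) -> V z1 = V z2 -> z1 = z2).
  { intros z1 z2 H1 H2 E1 E2 EV. apply Hinj; trivial.
    assert (E : (c * f z1 = c * f z2)%C).
    { apply C_eq_Re_Im; [|exact EV]. unfold f. rewrite !Hre by assumption. congruence. }
    apply (f_equal (Cmult (/ c))) in E.
    rewrite !Cmult_assoc, Cinv_l, !Cmult_1_l in E by exact Hc. exact E. }
  assert (Harms : forall (th : nat -> R -> R) (t0 : R), 0 < t0 <= r ->
    (forall k t, (k < 3)%nat -> 0 < t < t0 -> continuous (th k) t) ->
    (forall j k s t, (j < k)%nat -> (k < 3)%nat -> 0 < s < t0 -> 0 < t < t0 ->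
       0 < th k t - th j s < 2 * PI) ->
    (forall k t, (k < 3)%nat -> 0 < t < t0 -> Re (phi (arm alpha (th k) t)) = Re (phi alpha)) ->
    False).
  { intros th t0 Ht0 Hcont Hsep Hlev.
    assert (Hball : forall k t, 0 < t < t0 -> Cmod (arm alpha (th k) t - alpha) < r).
    { intros k t Ht. rewrite Cmod_arm, Rabs_pos_eq by lra. lra. }
    apply (no_three_arms V alpha th t0); trivial; try lra.
    - intros z Hz. apply HV. lra.
    - intros k t Hk Ht E. apply HVinj in E; auto.
      assert (K := Cmod_arm alpha (th k) t). rewrite E in K.
      replace (alpha - alpha)%C with (RtoC 0) in K by ring.
      rewrite Cmod_0, Rabs_pos_eq in K by lra. lra.
    - intros j k s t Hj Hk Hs Ht E. apply HVinj; auto. }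
  pose proof PI_RGT_0 as Hpi.
  destruct (least_nonzero d) as [Hconst | [n [Hn [Hdn Hmin]]]].
  - (* phi is constant, any three rays will do *)
    apply (Harms (fun k _ => INR k) r).
    + lra.
    + intros k t _ _. apply continuous_const.
    + intros j k s t Hjk Hk _ _. apply lt_INR in Hjk as Hjk'.
      assert (INR k <= 2) by (change 2 with (INR 2); apply le_INR; lia).
      pose proof (pos_INR j). pose proof PI2_1. lra.
    + intros k t _ Ht. f_equal. apply (series_on_const d alpha r phi); trivial.
      rewrite Cmod_arm, Rabs_pos_eq by lra. lra.
  - assert (Hn2 : (2 <= n)%nat).
    { destruct n as [|[|n]]; [lia| congruence | lia]. }
    destruct (series_on_factor d alpha r phi n Hr Hn Hphi Hmin Hdn)
        as (e & P & HP & HP1 & Hfac).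
    destruct (sector_root e P alpha r n Hr Hn HP HP1) as [t0 [Ht0 Hroot]].
    (* This beta makes d n * cis beta equal to i |d n|, so that the real part of
       phi - phi alpha vanishes to leading order at the angles
       (beta + k pi) / n. *)
    destruct (polar_form (Ci * Cconj (d n))) as [beta Hbeta].
    assert (Hk : forall k : nat, exists xi : R -> R, forall t, 0 < t < t0 ->
      - (PI / 4) <= xi t <= PI / 4 /\
      sector_fun P alpha n (beta + INR k * PI) t (xi t) = 0 /\ continuous xi t)
      by (intros k; apply Hroot).
    apply functional_choice in Hk. destruct Hk as [xi Hxi].
    assert (Hn2R : 2 <= INR n) by (change 2 with (INR 2); now apply le_INR).
    apply (Harms (fun k t => (beta + INR k * PI + xi k t) / INR n) t0); trivial.
    + intros k t _ Ht. destruct (Hxi k t Ht) as [_ [_ C]].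
      apply (continuous_mult (K := R_AbsRing)); [|apply continuous_const].
      apply (continuous_plus (V := R_NormedModule)); [apply continuous_const | exact C].
    + intros j k s t Hjk Hk3 Hs Ht.
      destruct (Hxi j s Hs) as [B1 _]. destruct (Hxi k t Ht) as [B2 _].
      assert (Hkj : 1 <= INR k - INR j <= 2).
      { rewrite <- minus_INR by lia. split.
        - change 1 with (INR 1). apply le_INR. lia.
        - change 2 with (INR 2). apply le_INR. lia. }
      set (m := INR k - INR j) in *.
      replace ((beta + INR k * PI + xi k t) / INR n - (beta + INR j * PI + xi j s) / INR n)
        with ((m * PI + (xi k t - xi j s)) / INR n) by (unfold m; field; lra).
      assert (PI / 2 <= m * PI + (xi k t - xi j s) <= 5 / 2 * PI) by nra.
      split.
      * apply Rdiv_lt_0_compat; lra.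
      * apply Rlt_div_l; nra.
    + intros k t _ Ht. destruct (Hxi k t Ht) as [_ [S _]].
      set (th := fun t => (beta + INR k * PI + xi k t) / INR n).
      change (Re (phi (arm alpha th t)) = Re (phi alpha)).
      assert (Hz : Cmod (arm alpha th t - alpha) < r)
        by (rewrite Cmod_arm, Rabs_pos_eq by lra; lra).
      assert (F := Hfac _ Hz).
      replace (arm alpha th t - alpha)%C with (t * cis (th t))%C in F by (unfold arm; ring).
      rewrite Cpow_mult_l, cis_pow in F.
      replace (INR n * th t) with (beta + (INR k * PI + xi k t)) in F by (unfold th; field;
          lra).
      rewrite !cis_plus in F.
      change (sector_fun P alpha n (beta + INR k * PI) t (xi k t))
        with (Im (cis (xi k t) * P (arm alpha th t))) in S.
      assert (Hdb : (d n * cis beta = Ci * Cmod (d n))%C).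
      { assert (Hm : Cmod (Ci * Cconj (d n)) = Cmod (d n))
          by (rewrite Cmod_mult, Cmod_Ci, Cmod_conj; ring).
        rewrite Hm in Hbeta.
        assert (Hnz : RtoC (Cmod (d n)) <> RtoC 0)
          by (intros E; apply RtoC_inj in E; apply Hdn; now apply Cmod_eq_0).
        transitivity (d n * (Cmod (d n) * cis beta) / Cmod (d n))%C; [field; exact Hnz|].
        rewrite <- Hbeta.
        transitivity (Ci * (d n * Cconj (d n)) / Cmod (d n))%C; [field; exact Hnz|].
        rewrite <- Cmod2_conj, RtoC_pow. field. exact Hnz. }
      assert (Hkpi : exists s : R, cis (INR k * PI) = RtoC s).
      { exists (cos (INR k * PI)). unfold cis, RtoC. f_equal.
        rewrite INR_IZR_INZ. apply sin_eq_0_1. eexists. reflexivity. }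
      destruct Hkpi as [s Hs]. rewrite Hs in F.
      assert (E : (phi (arm alpha th t) - phi alpha
         = (Cmod (d n) * t ^ n * s) * (Ci * (cis (xi k t) * P (arm alpha th t))))%C).
      { rewrite F, <- RtoC_pow.
        transitivity ((d n * cis beta) * ((t ^ n)%R * s * (cis (xi k t)
            * P (arm alpha th t))))%C; [ring|].
        rewrite Hdb, RtoC_pow. ring. }
      apply (f_equal Re) in E. rewrite <- RtoC_pow, <- !RtoC_mult, re_scal_l in E.
      rewrite (Cmult_comm Ci), re_mult_Ci, S in E. unfold Cminus in E.
      rewrite re_plus, re_opp in E. lra.
Qed.

Lemma lewy (h g : C -> C) (alpha : C) (a b : nat -> C) (r : R) :
  0 < r -> series_on a alpha r h -> series_on b alpha r g ->
  (forall z1 z2, Cmod (z1 - alpha) < r -> Cmod (z2 - alpha) < r ->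
     (h z1 + Cconj (g z1) = h z2 + Cconj (g z2))%C -> z1 = z2) ->
  jacobian h g alpha <> 0.
Proof.
  intros Hr Hh Hg Hinj HJ. unfold jacobian in HJ.
  rewrite (series_on_C_derive_center _ _ _ _ Hh Hr),
      (series_on_C_derive_center _ _ _ _ Hg Hr) in HJ.
  destruct (critical_direction (a 1%nat) (b 1%nat)) as [c [Hc Hcab]].
  { pose proof (Cmod_ge_0 (a 1%nat)). pose proof (Cmod_ge_0 (b 1%nat)). nra. }
  apply (no_critical_injective h g (fun z => c * h z + Cconj c * g z)%C c alpha a b
    (fun n => c * a n + Cconj c * b n)%C r); trivial.
  - now apply series_on_lin.
  - intros z _. apply Re_conj_swap.
Qed.

(** * Jets with respect to the Wirtinger derivative *)

(** The functions F1, F2, F3 are needed on a whole disc, since each is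
    differentiated again; only their values at alpha are kept. *)
Definition jet (rho : R) (alpha : C) (F : C -> C) (v0 v1 v2 v3 : C) : Prop :=
  exists F1 F2 F3 : C -> C,
    (forall z, Cmod (z - alpha) < rho ->
       is_Dz F z (F1 z) /\ is_Dz F1 z (F2 z) /\ is_Dz F2 z (F3 z)) /\
    F alpha = v0 /\ F1 alpha = v1 /\ F2 alpha = v2 /\ F3 alpha = v3.

Lemma jet_correct (rho : R) (alpha : C) (F : C -> C) (v0 v1 v2 v3 : C) :
  0 < rho -> jet rho alpha F v0 v1 v2 v3 ->
  (forall z, Cmod (z - alpha) < rho -> ex_Dz F z /\ ex_Dz (Dz F) z /\ ex_Dz (Dz (Dz F)) z) /\
  F alpha = v0 /\ Dz F alpha = v1 /\ Dz (Dz F) alpha = v2 /\ Dz (Dz (Dz F)) alpha = v3.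
Proof.
  intros Hrho (F1 & F2 & F3 & H & <- & <- & <- & <-).
  assert (H1 : forall z, Cmod (z - alpha) < rho -> is_Dz F z (F1 z)) by apply H.
  assert (H2 : forall z, Cmod (z - alpha) < rho -> is_Dz (Dz F) z (F2 z)).
  { intros z Hz. apply (is_Dz_ext_ball rho alpha F1); [|trivial|now apply H].
    intros w Hw. symmetry. now apply is_Dz_correct, H1. }
  assert (H3 : forall z, Cmod (z - alpha) < rho -> is_Dz (Dz (Dz F)) z (F3 z)).
  { intros z Hz. apply (is_Dz_ext_ball rho alpha F2); [|trivial|now apply H].
    intros w Hw. symmetry. now apply is_Dz_correct, H2. }
  pose proof (Cmod_center alpha rho Hrho) as Hc.
  split; [intros z Hz; repeat split|split; [reflexivity|split; [|split]]].
  1,2: apply (is_Dz_correct _ _ _ (H1 z Hz)).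
  1,2: apply (is_Dz_correct _ _ _ (H2 z Hz)).
  1,2: apply (is_Dz_correct _ _ _ (H3 z Hz)).
  - apply (is_Dz_correct _ _ _ (H1 _ Hc)).
  - apply (is_Dz_correct _ _ _ (H2 _ Hc)).
  - apply (is_Dz_correct _ _ _ (H3 _ Hc)).
Qed.

Lemma jet_eq (rho : R) (alpha : C) (F : C -> C) (v0 v1 v2 v3 w0 w1 w2 w3 : C) :
  jet rho alpha F v0 v1 v2 v3 -> v0 = w0 -> v1 = w1 -> v2 = w2 -> v3 = w3 ->
  jet rho alpha F w0 w1 w2 w3.
Proof. now intros H <- <- <- <-. Qed.

Lemma jet_small (rho rho' : R) (alpha : C) (F : C -> C) (v0 v1 v2 v3 : C) :
  rho' <= rho -> jet rho alpha F v0 v1 v2 v3 -> jet rho' alpha F v0 v1 v2 v3.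
Proof.
  intros Hle (F1 & F2 & F3 & H & E). exists F1, F2, F3. split; [|exact E].
  intros z Hz. apply H. lra.
Qed.

Lemma jet_ext (rho : R) (alpha : C) (F G : C -> C) (v0 v1 v2 v3 : C) :
  0 < rho -> (forall z, Cmod (z - alpha) < rho -> F z = G z) ->
  jet rho alpha F v0 v1 v2 v3 -> jet rho alpha G v0 v1 v2 v3.
Proof.
  intros Hrho E (F1 & F2 & F3 & H & E0 & E1). exists F1, F2, F3. split.
  - intros z Hz. destruct (H z Hz) as [K K']. split; [|exact K'].
    now apply (is_Dz_ext_ball rho alpha F).
  - split; [|exact E1]. rewrite <- E; [exact E0|]. now apply Cmod_center.
Qed.

Lemma jet_nonzero (rho : R) (alpha : C) (F : C -> C) (v0 v1 v2 v3 : C) :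
  0 < rho -> jet rho alpha F v0 v1 v2 v3 -> v0 <> RtoC 0 ->
  exists rho', 0 < rho' <= rho /\ forall z, Cmod (z - alpha) < rho' -> F z <> RtoC 0.
Proof.
  intros Hrho (F1 & F2 & F3 & H & E0 & E1) Hv.
  assert (Hpos : 0 < Cmod v0) by now apply Cmod_gt_0.
  destruct (H alpha (Cmod_center alpha rho Hrho)) as [K _].
  destruct (proj1 (locally_Cmod _ _) (is_Dz_continuous F alpha _ _ K Hpos)) as [d [Hd HK]].
  exists (Rmin rho d). split.
  - split; [now apply Rmin_pos | apply Rmin_l].
  - intros z Hz Hz0. specialize (HK z (Rlt_le_trans _ _ _ Hz (Rmin_r _ _))).
    rewrite Hz0, E0 in HK. replace (0 - v0)%C with (- v0)%C in HK by ring.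
    rewrite Cmod_opp in HK. lra.
Qed.

Lemma jet_const (rho : R) (alpha c : C) : jet rho alpha (fun _ => c) c 0 0 0.
Proof.
  exists (fun _ => RtoC 0), (fun _ => RtoC 0), (fun _ => RtoC 0).
  split; [|repeat split]. intros z _. split; [|split]; apply is_Dz_const.
Qed.

Lemma jet_id (rho : R) (alpha : C) : jet rho alpha (fun z => z) alpha 1 0 0.
Proof.
  exists (fun _ => RtoC 1), (fun _ => RtoC 0), (fun _ => RtoC 0).
  split; [|repeat split]. intros z _. split; [|split; apply is_Dz_const].
  apply is_Dz_holo. apply is_derive_of_bound with (K := 0) (rho := 1); [lra|].
  intros w _. replace (w - z - (w - z) * 1)%C with (RtoC 0) by ring. rewrite Cmod_0. lra.
Qed.

Lemma jet_plus (rho : R) (alpha : C) (F G : C -> C) (u0 u1 u2 u3 v0 v1 v2 v3 : C) :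
  jet rho alpha F u0 u1 u2 u3 -> jet rho alpha G v0 v1 v2 v3 ->
  jet rho alpha (fun z => F z + G z)%C (u0 + v0) (u1 + v1) (u2 + v2) (u3 + v3).
Proof.
  intros (F1 & F2 & F3 & H & <- & <- & <- & <-) (G1 & G2 & G3 & K & <- & <- & <- & <-).
  exists (fun z => F1 z + G1 z)%C, (fun z => F2 z + G2 z)%C, (fun z => F3 z + G3 z)%C.
  split; [|repeat split]. intros z Hz.
  destruct (H z Hz) as [A1 [A2 A3]]. destruct (K z Hz) as [B1 [B2 B3]].
  split; [|split]; now apply is_Dz_plus.
Qed.

Lemma jet_mult (rho : R) (alpha : C) (F G : C -> C) (u0 u1 u2 u3 v0 v1 v2 v3 : C) :
  jet rho alpha F u0 u1 u2 u3 -> jet rho alpha G v0 v1 v2 v3 ->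
  jet rho alpha (fun z => F z * G z)%C (u0 * v0) (u1 * v0 + u0 * v1)
    (u2 * v0 + 2 * (u1 * v1) + u0 * v2)
    (u3 * v0 + 3 * (u2 * v1) + 3 * (u1 * v2) + u0 * v3).
Proof.
  intros (F1 & F2 & F3 & H & <- & <- & <- & <-) (G1 & G2 & G3 & K & <- & <- & <- & <-).
  exists (fun z => F1 z * G z + F z * G1 z)%C,
    (fun z => F2 z * G z + 2 * (F1 z * G1 z) + F z * G2 z)%C,
    (fun z => F3 z * G z + 3 * (F2 z * G1 z) + 3 * (F1 z * G2 z) + F z * G3 z)%C.
  split; [|repeat split]. intros z Hz.
  destruct (H z Hz) as [A1 [A2 A3]]. destruct (K z Hz) as [B1 [B2 B3]].
  split; [|split].
  - now apply is_Dz_mult.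
  - eapply is_Dz_eq; [apply is_Dz_plus; apply is_Dz_mult; eassumption|]. cbv beta. ring.
  - eapply is_Dz_eq; [apply is_Dz_plus; [apply is_Dz_plus|]; apply is_Dz_mult;
      [eassumption|eassumption|apply is_Dz_const|apply is_Dz_mult;
          eassumption|eassumption|eassumption]|]. cbv beta. ring.
Qed.

Lemma jet_minus (rho : R) (alpha : C) (F G : C -> C) (u0 u1 u2 u3 v0 v1 v2 v3 : C) :
  0 < rho -> jet rho alpha F u0 u1 u2 u3 -> jet rho alpha G v0 v1 v2 v3 ->
  jet rho alpha (fun z => F z - G z)%C (u0 - v0) (u1 - v1) (u2 - v2) (u3 - v3).
Proof.
  intros Hrho H K.
  apply (jet_ext rho alpha (fun z => F z + (- (1)) * G z)%C); trivial; [intros; ring|].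
  eapply jet_eq; [apply jet_plus; [exact H|apply jet_mult; [apply jet_const|exact K]]|..];
      cbv beta; ring.
Qed.

Lemma jet_inv (rho : R) (alpha : C) (F : C -> C) (v0 v1 v2 v3 : C) :
  0 < rho -> (forall z, Cmod (z - alpha) < rho -> F z <> RtoC 0) ->
  jet rho alpha F v0 v1 v2 v3 ->
  jet rho alpha (fun z => / F z)%C (/ v0) (- v1 / (v0 * v0))
    (2 * (v1 * v1) / (v0 * v0 * v0) - v2 / (v0 * v0))
    (- (6) * (v1 * v1 * v1) / (v0 * v0 * v0 * v0) + 6 * (v1 * v2) / (v0 * v0 * v0)
      - v3 / (v0 * v0)).
Proof.
  intros Hrho Hne (F1 & F2 & F3 & H & <- & <- & <- & <-).
  set (I := fun z => (/ F z)%C).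
  exists (fun z => (- (1)) * F1 z * (I z * I z))%C,
    (fun z => 2 * (F1 z * F1 z) * (I z * I z * I z) + (- (1)) * F2 z * (I z * I z))%C,
    (fun z => (- (6)) * (F1 z * F1 z * F1 z) * (I z * I z * I z * I z)
       + 6 * (F1 z * F2 z) * (I z * I z * I z) + (- (1)) * F3 z * (I z * I z))%C.
  assert (Ha := Hne alpha (Cmod_center alpha rho Hrho)).
  split; [|unfold I; repeat split; field; exact Ha].
  intros z Hz. specialize (Hne z Hz). destruct (H z Hz) as [A1 [A2 A3]].
  assert (HI : is_Dz I z (- (1) * F1 z * (I z * I z))%C).
  { eapply is_Dz_eq; [apply is_Dz_inv; eassumption|]. unfold I. field. exact Hne. }
  split; [exact HI|].
  pose proof (is_Dz_mult _ _ _ _ _ HI HI) as HI2.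
  pose proof (is_Dz_mult _ _ _ _ _ HI2 HI) as HI3.
  split.
  - eapply is_Dz_eq; [apply is_Dz_mult; [apply is_Dz_mult;
      [apply is_Dz_const|eassumption]|exact HI2]|]. cbv beta. ring.
  - eapply is_Dz_eq; [apply is_Dz_plus; apply is_Dz_mult;
     [apply is_Dz_mult; [apply is_Dz_const|apply is_Dz_mult; eassumption] | exact HI3
     |apply is_Dz_mult; [apply is_Dz_const|eassumption] | exact HI2]|]. cbv beta. ring.
Qed.

Lemma jet_holo (rho : R) (alpha : C) (a : nat -> C) (f : C -> C) :
  series_on a alpha rho f ->
  jet rho alpha f (f alpha) (C_derive f alpha) (C_derive (C_derive f) alpha)
    (C_derive (C_derive (C_derive f)) alpha).
Proof.
  intros H0. pose proof (series_on_derive _ _ _ _ H0) as H1.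
  pose proof (series_on_derive _ _ _ _ H1) as H2.
  eexists _, _, _. split; [|repeat split].
  intros z Hz. split; [|split]; apply is_Dz_holo; eapply series_on_C_derive; eassumption.
Qed.

Lemma jet_antiholo (rho : R) (alpha : C) (a : nat -> C) (f : C -> C) :
  series_on a alpha rho f ->
  jet rho alpha (fun z => Cconj (f z)) (Cconj (f alpha)) 0 0 0.
Proof.
  intros H0. exists (fun _ => RtoC 0), (fun _ => RtoC 0), (fun _ => RtoC 0).
  split; [|repeat split]. intros z Hz. split; [|split; apply is_Dz_const].
  eapply is_Dz_antiholo, series_on_C_derive; eassumption.
Qed.

(** * The harmonic Schwarzian derivative and the Halley map *)

Lemma jacobian_conj (h g : C -> C) (z : C) :
  RtoC (jacobian h g z) = (Cconj (C_derive h z) * C_derive h z - Cconj (C_derive g z)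
      * C_derive g z)%C.
Proof. unfold jacobian. rewrite RtoC_minus, !Cmod2_conj. ring. Qed.

Lemma jet_jacobian (rho : R) (alpha : C) (a b : nat -> C) (h g : C -> C) :
  0 < rho -> series_on a alpha rho h -> series_on b alpha rho g ->
  let D := C_derive in
  let k := Cconj (D h alpha) in let l := Cconj (D g alpha) in
  jet rho alpha (fun z => RtoC (jacobian h g z))
    (k * D h alpha - l * D g alpha)
    (k * D (D h) alpha - l * D (D g) alpha)
    (k * D (D (D h)) alpha - l * D (D (D g)) alpha)
    (k * D (D (D (D h))) alpha - l * D (D (D (D g))) alpha).
Proof.
  intros Hrho Hh Hg D k l.
  pose proof (series_on_derive _ _ _ _ Hh) as Hh1.
  pose proof (series_on_derive _ _ _ _ Hg) as Hg1.
  apply (jet_ext rho alpha (fun z => Cconj (D h z) * D h z - Cconj (D g z) * D g z)%C); trivial.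
  { intros z _. symmetry. apply jacobian_conj. }
  eapply jet_eq; [apply jet_minus; [trivial| |];
    (apply jet_mult; [eapply jet_antiholo; eassumption | eapply jet_holo; eassumption])|..];
  unfold k, l, D; ring.
Qed.

Lemma schwarzian_pos_jet (rho : R) (alpha : C) (h g : C -> C) (j0 j1 j2 j3 : C) :
  0 < rho -> jet rho alpha (fun z => RtoC (jacobian h g z)) j0 j1 j2 j3 ->
  0 < jacobian h g alpha ->
  schwarzian_pos h g alpha = (j2 / j0 - 3 / 2 * ((j1 / j0) * (j1 / j0)))%C.
Proof.
  intros Hrho (J1 & J2 & J3 & H & <- & <- & <- & <-) Hpos.
  assert (Hc := Cmod_center alpha rho Hrho).
  destruct (H alpha Hc) as [H1 [H2 _]].
  destruct (proj1 (locally_Cmod _ _) (is_Dz_continuous _ _ _ _ H1 Hpos)) as [d [Hd HK]].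
  set (r := Rmin rho d).
  assert (Hr : 0 < r) by now apply Rmin_pos.
  assert (HJ : forall z, Cmod (z - alpha) < r -> 0 < jacobian h g z).
  { intros z Hz. specialize (HK z (Rlt_le_trans _ _ _ Hz (Rmin_r _ _))).
    rewrite <- RtoC_minus, Cmod_R in HK. apply Rabs_def2 in HK. lra. }
  assert (HP : forall z, Cmod (z - alpha) < r ->
      pre_schwarzian_pos h g z = (J1 z / jacobian h g z)%C).
  { intros z Hz. apply is_Dz_correct, is_Dz_ln; [now apply HJ|].
    apply H. apply Rlt_le_trans with (1 := Hz), Rmin_l. }
  assert (Hcr := Cmod_center alpha r Hr).
  assert (Hne : RtoC (jacobian h g alpha) <> RtoC 0) by (intros E; apply RtoC_inj in E; lra).
  assert (HD : is_Dz (pre_schwarzian_pos h g) alpha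
    (J2 alpha / jacobian h g alpha - (J1 alpha / jacobian h g alpha)
        * (J1 alpha / jacobian h g alpha))%C).
  { apply (is_Dz_ext_ball r alpha (fun z => J1 z * / jacobian h g z)%C); trivial.
    { intros z Hz. now rewrite HP. }
    eapply is_Dz_eq; [apply is_Dz_mult;
        [exact H2|apply (is_Dz_inv (fun z => RtoC (jacobian h g z))); eassumption]|].
    cbv beta. field. exact Hne. }
  unfold schwarzian_pos. rewrite (proj2 (is_Dz_correct _ _ _ HD)), HP by exact Hcr.
  field. exact Hne.
Qed.

(** Exchanging h and g changes the sign of J and of its derivatives, which the
    quotients do not see; so both orientations give one formula. *)
Lemma harmonic_schwarzian_jet (rho : R) (alpha : C) (a b : nat -> C) (h g : C -> C) :
  0 < rho -> series_on a alpha rho h -> series_on b alpha rho g -> jacobian h g alpha <> 0 ->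
  let D := C_derive in
  let k := Cconj (D h alpha) in let l := Cconj (D g alpha) in
  let j0 := (k * D h alpha - l * D g alpha)%C in
  let j1 := (k * D (D h) alpha - l * D (D g) alpha)%C in
  let j2 := (k * D (D (D h)) alpha - l * D (D (D g)) alpha)%C in
  harmonic_schwarzian h g alpha = (j2 / j0 - 3 / 2 * ((j1 / j0) * (j1 / j0)))%C.
Proof.
  intros Hrho Hh Hg HJ D k l j0 j1 j2.
  assert (Hj0 : j0 <> RtoC 0).
  { unfold j0, k, l, D. rewrite <- jacobian_conj. intros E. now apply RtoC_inj in E. }
  unfold harmonic_schwarzian.
  pose proof (Cmod_ge_0 (C_derive h alpha)). pose proof (Cmod_ge_0 (C_derive g alpha)).
  destruct (Rlt_dec _ _) as [Hlt|Hge].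
  - refine (schwarzian_pos_jet _ _ _ _ _ _ _ _ Hrho (jet_jacobian _ _ _ _ _ _ Hrho Hh Hg) _).
    unfold jacobian. nra.
  - rewrite (schwarzian_pos_jet _ _ _ _ _ _ _ _ Hrho (jet_jacobian _ _ _ _ _ _ Hrho Hg Hh)).
    + fold D. fold k l.
      replace (l * D g alpha - k * D h alpha)%C with (- j0)%C by (unfold j0; ring).
      replace (l * D (D g) alpha - k * D (D h) alpha)%C with (- j1)%C by (unfold j1; ring).
      replace (l * D (D (D g)) alpha - k * D (D (D h)) alpha)%C with (- j2)%C by (unfold j2;
          ring).
      field. exact Hj0.
    + unfold jacobian in *. nra.
Qed.

Lemma halley_map_jet (h g f : C -> C) (alpha : C) (a b : nat -> C) (r : R) :
  0 < r -> series_on a alpha r h -> series_on b alpha r g ->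
  (forall z, Cmod (z - alpha) < r -> f z = (h z + Cconj (g z))%C) ->
  f alpha = RtoC 0 -> jacobian h g alpha <> 0 ->
  let h' := C_derive h in let g' := C_derive g in
  let k := Cconj (h' alpha) in let l := Cconj (g' alpha) in
  let j0 := (k * h' alpha - l * g' alpha)%C in
  let j1 := (k * C_derive h' alpha - l * C_derive g' alpha)%C in
  let j2 := (k * C_derive (C_derive h') alpha - l * C_derive (C_derive g') alpha)%C in
  exists rho, 0 < rho /\
    (forall z, Cmod (z - alpha) < rho -> jacobian h g z <> 0 /\ halley_B f h g z <> 0) /\
    jet rho alpha (halley_map f h g) alpha 0 0
      (- (j2 / j0 - 3 / 2 * ((j1 / j0) * (j1 / j0)))).
Proof.
  intros Hr Hh Hg Hf Hzero HJ h' g' k1 l1 j0 j1 j2.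
  set (h'' := C_derive h'). set (g'' := C_derive g').
  set (h1 := h' alpha). set (h2 := h'' alpha). set (h3 := C_derive h'' alpha).
  set (g1 := g' alpha). set (g2 := g'' alpha). set (g3 := C_derive g'' alpha).
  set (h4 := C_derive (C_derive h'') alpha). set (g4 := C_derive (C_derive g'') alpha).
  set (h5 := C_derive (C_derive (C_derive h'')) alpha).
  set (g5 := C_derive (C_derive (C_derive g'')) alpha).
  set (k2 := Cconj h2). set (l2 := Cconj g2).
  change (k1 * h1 - l1 * g1)%C in (value of j0). change (k1 * h2 - l1 * g2)%C in (value of j1).
  change (k1 * h3 - l1 * g3)%C in (value of j2).
  set (j3 := (k1 * h4 - l1 * g4)%C).
  set (m2 := (h2 * g1 - g2 * h1)%C). set (e1 := (k2 * h1 - l2 * g1)%C).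
  pose proof (series_on_derive _ _ _ _ Hh) as Hh1.
  pose proof (series_on_derive _ _ _ _ Hh1) as Hh2.
  pose proof (series_on_derive _ _ _ _ Hg) as Hg1.
  pose proof (series_on_derive _ _ _ _ Hg1) as Hg2.
  assert (Hj0 : j0 <> RtoC 0).
  { intros E. apply HJ, RtoC_inj. rewrite jacobian_conj. exact E. }
  destruct (jet_nonzero _ _ _ _ _ _ _ Hr (jet_jacobian _ _ _ _ _ _ Hr Hh Hg) Hj0)
      as [r1 [Hr1 HJ1]].
  assert (S : forall F v0 v1 v2 v3, jet r alpha F v0 v1 v2 v3 -> jet r1 alpha F v0 v1 v2 v3)
    by (intros; eapply jet_small; [|eassumption]; lra).
  assert (Hpos : 0 < r1) by lra.
  assert (JJ : jet r1 alpha (fun z => RtoC (jacobian h g z)) j0 j1 j2 j3)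
    by exact (S _ _ _ _ _ (jet_jacobian _ _ _ _ _ _ Hr Hh Hg)).
  assert (Jh : jet r1 alpha h (h alpha) h1 h2 h3) by exact (S _ _ _ _ _ (jet_holo _ _ _ _ Hh)).
  assert (Jh1 : jet r1 alpha h' h1 h2 h3 h4) by exact (S _ _ _ _ _ (jet_holo _ _ _ _ Hh1)).
  assert (Jh2 : jet r1 alpha h'' h2 h3 h4 h5) by exact (S _ _ _ _ _ (jet_holo _ _ _ _ Hh2)).
  assert (Jg : jet r1 alpha g (g alpha) g1 g2 g3) by exact (S _ _ _ _ _ (jet_holo _ _ _ _ Hg)).
  assert (Jg1 : jet r1 alpha g' g1 g2 g3 g4) by exact (S _ _ _ _ _ (jet_holo _ _ _ _ Hg1)).
  assert (Jg2 : jet r1 alpha g'' g2 g3 g4 g5) by exact (S _ _ _ _ _ (jet_holo _ _ _ _ Hg2)).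
  pose proof (S _ _ _ _ _ (jet_antiholo _ _ _ _ Hh)) as Kh.
  assert (Kh1 : jet r1 alpha (fun z => Cconj (h' z)) k1 0 0 0)
    by exact (S _ _ _ _ _ (jet_antiholo _ _ _ _ Hh1)).
  assert (Kh2 : jet r1 alpha (fun z => Cconj (h'' z)) k2 0 0 0)
    by exact (S _ _ _ _ _ (jet_antiholo _ _ _ _ Hh2)).
  pose proof (S _ _ _ _ _ (jet_antiholo _ _ _ _ Hg)) as Kg.
  assert (Kg1 : jet r1 alpha (fun z => Cconj (g' z)) l1 0 0 0)
    by exact (S _ _ _ _ _ (jet_antiholo _ _ _ _ Hg1)).
  assert (Kg2 : jet r1 alpha (fun z => Cconj (g'' z)) l2 0 0 0)
    by exact (S _ _ _ _ _ (jet_antiholo _ _ _ _ Hg2)).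
  clearbody h4 h5 g4 g5. clear S.
  assert (Ha := Hf alpha (Cmod_center _ _ Hr)). rewrite Hzero in Ha.
  assert (Ha' : (Cconj (h alpha) + g alpha)%C = RtoC 0).
  { rewrite <- (Cconj_conj (g alpha)), <- Cplus_conj, <- Ha. apply Cconj_RtoC. }
  assert (Jf : jet r1 alpha f 0 h1 h2 h3).
  { apply (jet_ext r1 alpha (fun z => h z + Cconj (g z))%C); trivial.
    - intros z Hz. symmetry. apply Hf. lra.
    - eapply jet_eq; [exact (jet_plus _ _ _ _ _ _ _ _ _ _ _ _ Jh Kg)|..]; try ring.
    now rewrite <- Ha. }
  assert (Jfb : jet r1 alpha (fun z => Cconj (f z)) 0 g1 g2 g3).
  { apply (jet_ext r1 alpha (fun z => Cconj (h z) + g z)%C); trivial.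
    - intros z Hz. rewrite Hf by lra. now rewrite Cplus_conj, Cconj_conj.
    - eapply jet_eq; [exact (jet_plus _ _ _ _ _ _ _ _ _ _ _ _ Kh Jg)|..]; try ring. exact Ha'. }
  assert (JN : jet r1 alpha (halley_N f h g) 0 j0 j1 j2).
  { apply (jet_ext r1 alpha (fun z => Cconj (h' z) * f z - Cconj (g' z) * Cconj (f z))%C);
      trivial.
    - intros z Hz. unfold halley_N. now rewrite Cmult_conj.
    - eapply jet_eq; [apply jet_minus; [trivial| |]; apply jet_mult; eassumption|..];
      unfold j0, j1, j2; ring. }
  (* The third-order entries m3, p3, q3 below get no name in closed form: in A they
     are multiplied by the values of f and conj f at alpha, which are 0, and in B
     they enter only the third-order entry. *)
  assert (JNb : exists m3, jet r1 alpha (fun z => Cconj (halley_N f h g z)) 0 0 m2 m3).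
  { eexists. apply (jet_ext r1 alpha (fun z => h' z * Cconj (f z) - g' z * f z)%C); trivial.
    - intros z Hz. unfold halley_N. now rewrite Cminus_conj, !Cmult_conj, !Cconj_conj.
    - eapply jet_eq; [apply jet_minus; [trivial| |]; apply jet_mult; eassumption|..];
        [| | |reflexivity];
      unfold m2; ring. }
  destruct JNb as [m3 JNb].
  pose proof (jet_inv _ _ _ _ _ _ _ Hpos HJ1 JJ) as JI. cbv beta in JI.
  assert (JL : exists p3, jet r1 alpha (fun z => halley_N f h g z / jacobian h g z)%C 0 1 (-
      j1 / j0) p3).
  { eexists. eapply jet_eq; [exact (jet_mult _ _ _ _ _ _ _ _ _ _ _ _ JN JI)|..];
      [| | |reflexivity];
    field; exact Hj0. }
  destruct JL as [p3 JL].
  assert (JM : exists q3, jet r1 alpha (fun z => Cconj (halley_N f h g z)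
      / jacobian h g z)%C 0 0 (m2 / j0) q3).
  { eexists. eapply jet_eq; [exact (jet_mult _ _ _ _ _ _ _ _ _ _ _ _ JNb JI)|..];
      [| | |reflexivity];
    field; exact Hj0. }
  destruct JM as [q3 JM].
  assert (JA : jet r1 alpha (halley_A f h g) 0 j0 j1 (j2 - 3 / 2 * (m2 / j0) * e1)).
  { eapply jet_eq; [apply jet_minus; [trivial| |]; (apply jet_mult; [apply jet_minus;
      [trivial|eassumption|
       apply jet_mult; [apply (jet_mult _ _ _ (fun _ => / 2)%C);
           [eassumption|apply jet_const]|exact JM]]|eassumption])|..];
    unfold j0, j1, j2, e1 in *; field; try exact Hj0. }
  (* As J is real, the squared moduli in B are products of a factor with its
     formal conjugate; b3 will be multiplied by the value A(alpha) = 0. *)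
  assert (JB : exists b3, jet r1 alpha (fun z => RtoC (halley_B f h g z)) j0 (j1 / 2)
     (j1 * j1 / (2 * j0) - m2 / j0 * e1 / 2) b3).
  { eexists. apply (jet_ext r1 alpha (fun z =>
      (h' z - h'' z / 2 * (halley_N f h g z / jacobian h g z)) *
      (Cconj (h' z) - Cconj (h'' z) / 2 * (Cconj (halley_N f h g z) / jacobian h g z))
      - (g' z - g'' z / 2 * (halley_N f h g z / jacobian h g z)) *
      (Cconj (g' z) - Cconj (g'' z) / 2 * (Cconj (halley_N f h g z) / jacobian h g z)))%C);
          trivial.
    - intros z Hz. unfold halley_B. rewrite RtoC_minus, !Cmod2_conj.
      assert (Hz2 : RtoC 2 <> RtoC 0) by (intros E; apply RtoC_inj in E; lra).
      assert (HzJ := HJ1 z Hz).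
      rewrite !Cminus_conj, !Cmult_conj, !Cdiv_conj, !Cconj_RtoC by assumption.
      reflexivity.
    - eapply jet_eq; [apply jet_minus; [trivial| |]; (apply jet_mult; (apply jet_minus;
        [trivial|eassumption|
       apply jet_mult; [apply (jet_mult _ _ _ (fun _ => / 2)%C);
           [eassumption|apply jet_const]|eassumption]]))|..];
      [| | |reflexivity]; unfold j0, j1, j2, e1 in *; field; try exact Hj0. }
  destruct JB as [b3 JB].
  destruct (jet_nonzero _ _ _ _ _ _ _ Hpos JB Hj0) as [r2 [Hr2 HB2]].
  assert (Hr2' : r2 <= r1) by lra. assert (Hpos2 : 0 < r2) by lra.
  exists r2. split; [exact Hpos2|]. split.
  - intros z Hz. split; intros E.
    + apply (HJ1 z); [lra|now rewrite E].
    + apply (HB2 z Hz). now rewrite E.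
  - apply (jet_small _ _ _ _ _ _ _ _ Hr2') in JA, JB.
    eapply jet_eq; [apply jet_minus; [trivial|apply jet_id|
      apply jet_mult; [exact JA|exact (jet_inv _ _ _ _ _ _ _ Hpos2 HB2 JB)]]|..]; field;
          exact Hj0.
Qed.

Theorem theorem1 (Omega : C -> Prop) (f h g : C -> C) (alpha : C)
  (hOmega : simply_connected_domain Omega)
  (hh : analytic_on Omega h) (hg : analytic_on Omega g)
  (hf : forall z : C, Omega z -> f z = (h z + Cconj (g z))%C)
  (hharm : harmonic_on Omega f)
  (huniv : locally_univalent_on Omega f)
  (halpha : Omega alpha) (hzero : f alpha = RtoC 0) :
  let F := halley_map f h g in
  locally alpha (fun z : C =>
    jacobian h g z <> 0 /\ halley_B f h g z <> 0 /\
    ex_Dz F z /\ ex_Dz (Dz F) z /\ ex_Dz (Dz (Dz F)) z) /\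
  F alpha = alpha /\
  Dz F alpha = RtoC 0 /\
  Dz (Dz F) alpha = RtoC 0 /\
  Dz (Dz (Dz F)) alpha = (- harmonic_schwarzian h g alpha)%C.
Proof.
  intros F.
  destruct hOmega as [Hopen _].
  destruct (proj1 (locally_Cmod _ _) (Hopen alpha halpha)) as [r1 [Hr1 HO]].
  destruct (hh alpha halpha) as (a & r2 & Ha). destruct (hg alpha halpha) as (b & r3 & Hb).
  destruct (huniv alpha halpha) as (U & HUo & HUa & Hinj).
  destruct (proj1 (locally_Cmod _ _) (HUo alpha HUa)) as [r4 [Hr4 HU]].
  set (r := Rmin (Rmin r1 r2) (Rmin r3 r4)).
  assert (Hr : 0 < r) by (unfold r; repeat apply Rmin_pos; trivial; apply cond_pos).
  assert (Hle : r <= r1 /\ r <= r2 /\ r <= r3 /\ r <= r4).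
  { unfold r. pose proof (Rmin_l (Rmin r1 r2) (Rmin r3 r4)).
  pose proof (Rmin_r (Rmin r1 r2) (Rmin r3 r4)).
    pose proof (Rmin_l r1 r2). pose proof (Rmin_r r1 r2). pose proof (Rmin_l r3 r4).
    pose proof (Rmin_r r3 r4). lra. }
  destruct Hle as (L1 & L2 & L3 & L4).
  assert (Sh : series_on a alpha r h) by (apply (series_on_small _ _ r2); trivial).
  assert (Sg : series_on b alpha r g) by (apply (series_on_small _ _ r3); trivial).
  assert (Hf : forall z, Cmod (z - alpha) < r -> f z = (h z + Cconj (g z))%C)
    by (intros z Hz; apply hf, HO; lra).
  assert (HJ : jacobian h g alpha <> 0).
  { apply (lewy h g alpha a b r Hr Sh Sg). intros z1 z2 H1 H2 E.
    apply Hinj; try (apply HO; lra); try (apply HU; lra). now rewrite !Hf. }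
  destruct (halley_map_jet h g f alpha a b r Hr Sh Sg Hf hzero HJ) as (rho & Hrho & Hne & Hjet).
  destruct (jet_correct _ _ _ _ _ _ _ Hrho Hjet) as [Hex (E0 & E1 & E2 & E3)].
  split; [|split; [exact E0|split; [exact E1|split; [exact E2|]]]].
  - apply locally_Cmod. exists rho. split; [exact Hrho|]. intros z Hz.
    destruct (Hne z Hz). split; [|split]; trivial. now apply Hex.
  - unfold F. rewrite E3. now rewrite (harmonic_schwarzian_jet r alpha a b h g Hr Sh Sg HJ).
Qed.
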